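(* Let $X$ be an arbitrary $d$-dimensional semimartingale on $(\Omega,\mathcal F,(\mathcal F_t)_{t\ge0},\mathbb P)$ and let $f:\Omega\times\mathbb R_+\times\mathbb R^d\times\mathbb R^d\to\mathbb R^q$ satisfy the hypothesis $K[\mathbb R^d]$ given in the context. Suppose that there exist a neighborhood $V$ of $0$ in $\mathbb R^d$, a real $p>2$ and, for any $K>0$, a locally bounded process $\Gamma^K$ such that $$\|z\|\le K,\ x\in V\ \Longrightarrow\ \|f(\omega,s,z,x)\|\le \Gamma^K_s(\omega)\,\|x\|^p .$$ Then the processes $$V^n(f)_t=\sum_{i=1}^{[t/\Delta_n]} f\big(\omega,(i-1)\Delta_n,X_{(i-1)\Delta_n},X_{i\Delta_n}-X_{(i-1)\Delta_n}\big)$$ converge almost surely, for the Skorokhod topology, to the process $$D(f)_t=\sum_{s\le t} f(s-,X_{s-},\Delta X_s).$$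
   Context: $(\Omega,\mathcal F,(\mathcal F_t)_{t\ge 0},\mathbb P)$ is a fixed filtered probability space; $\Delta X_s=X_s-X_{s-}$ is the jump of $X$ at time $s$; $(\Delta_n)$ is a deterministic sequence of positive reals with $\Delta_n\to0$; $[\cdot]$ is the integer part. The arguments of $f$ are written $(\omega,t,z,x)$, and $\omega$ is often omitted. Hypothesis $K[A]$ (for $A\subset\mathbb R^d$): $f(\omega,t,z,x)$ is continuous in $(z,x)$ on $\mathbb R^d\times A$, and if $(t_n,z_n,x_n)\to(t,z,x)$ with $x\in A$ and $t_n<t$, then $f(\omega,t_n,z_n,x_n)$ converges to a limit depending only on $(\omega,t,z,x)$, denoted $f(\omega,t-,z,x)$. A process $\Gamma$ is locally bounded if there is a sequence $T_n$ of stopping times increasing a.s. to $\infty$ with $\sup_{s\le T_n}\Gamma_s\le n$. *)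

(* Defs.v *)
From HB Require Import structures.
From mathcomp Require Import all_boot all_order all_algebra.
From mathcomp Require Import all_classical all_reals all_analysis.

Set Implicit Arguments.
Unset Strict Implicit.
Unset Printing Implicit Defensive.

Import Order.TTheory GRing.Theory Num.Theory.
Import numFieldNormedType.Exports.

Local Open Scope classical_set_scope.
Local Open Scope ring_scope.

(* The library norm on matrices is the max norm. *)
Definition enorm (R : realType) (n : nat) (x : 'rV[R]_n) : R :=
  Num.sqrt (\sum_(j < n) x ord0 j ^+ 2).

(* Time is R_+: every process and path below is indexed by R, and only its
   values at times 0 <= t matter. *)

Section paths.
Context {R : realType} {E : uniformType}.

Definition cadlag (x : R -> E) : Prop :=
  (forall t : R, 0 <= t -> x s @[s --> t^'+] --> x t) /\
  (forall t : R, 0 < t -> exists l : E, x s @[s --> t^'-] --> l).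

Definition time_change (lam : R -> R) : Prop :=
  [/\ lam 0 = 0,
      {within `[0, +oo[, continuous lam},
      {in `[0, +oo[ &, {homo lam : s t / s < t}} &
      lam s @[s --> +oo] --> +oo].

(* Convergence of sequences in D(R_+, E) for Skorokhod's J1 topology, as in
   Jacod and Shiryaev, Limit Theorems for Stochastic Processes, VI.1.14. *)
Definition skorokhod_cvg (xn : nat -> R -> E) (x : R -> E) : Prop :=
  [/\ forall n, cadlag (xn n),
      cadlag x &
      exists lam : nat -> R -> R,
        [/\ forall n, time_change (lam n),
            {uniform `[0, +oo[, lam @ \oo --> (id : R -> R)} &
            forall N : R,
              {uniform `[0, N], (fun n => xn n \o lam n) @ \oo --> x}]].

End paths.

Section jumps.
Context {R : realType} {d : nat}.

Definition left_lim (x : R -> 'rV[R]_d) (t : R) : 'rV[R]_d :=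
  lim (x s @[s --> t^'-]).

Definition jump (x : R -> 'rV[R]_d) (t : R) : 'rV[R]_d := x t - left_lim x t.

End jumps.

Section processes.
Context {R : realType} {disp : measure_display} {Omega : measurableType disp}.
Variables (P : probability Omega R) (F : R -> set (set Omega)).

Definition filtration : Prop :=
  [/\ forall t : R, 0 <= t -> sigma_algebra setT (F t),
      forall t : R, 0 <= t -> F t `<=` measurable &
      forall s t : R, 0 <= s -> s <= t -> F s `<=` F t].

Definition stopping_time (T : Omega -> \bar R) : Prop :=
  (forall w, (0 <= T w)%E) /\
  (forall t : R, 0 <= t -> F t [set w | (T w <= t%:E)%E]).

Definition localizing (T : nat -> Omega -> \bar R) : Prop :=
  (forall n, stopping_time (T n)) /\
  {ae P, forall w, {homo T^~ w : m n / (m <= n)%N >-> (m <= n)%E} /\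
                   T n w @[n --> \oo] --> +oo%E}.

(* T n stands for the (n+1)-st stopping time of a sequence starting at 1. *)
Definition locally_bounded (G : R -> Omega -> R) : Prop :=
  exists2 T : nat -> Omega -> \bar R, localizing T &
    forall n w (s : R), 0 <= s -> (s%:E <= T n w)%E -> G s w <= n.+1%:R.

Definition adapted (Y : R -> Omega -> R) : Prop :=
  forall t : R, 0 <= t -> forall B : set R, measurable B -> F t (Y t @^-1` B).

(* The last clause is E[M_t | F_s] = M_s, i.e. the defining property of the
   conditional expectation (M_s being F_s-measurable and integrable). *)
Definition martingale (M : R -> Omega -> R) : Prop :=
  [/\ adapted M,
      forall t : R, 0 <= t -> P.-integrable setT (EFin \o M t) &
      forall s t : R, 0 <= s -> s <= t -> forall A, F s A ->
        (\int[P]_(w in A) (M t w)%:E = \int[P]_(w in A) (M s w)%:E)%E].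

Definition stopped (M : R -> Omega -> R) (T : Omega -> \bar R) :
    R -> Omega -> R :=
  fun t w => M (fine (mine t%:E (T w))) w.

Definition local_martingale (M : R -> Omega -> R) : Prop :=
  [/\ adapted M,
      forall w, cadlag (M^~ w) &
      exists2 T : nat -> Omega -> \bar R, localizing T &
        forall n, martingale (stopped M (T n))].

Definition finite_variation (A : R -> Omega -> R) : Prop :=
  [/\ adapted A,
      forall w, cadlag (A^~ w) &
      forall w (t : R), 0 <= t -> bounded_variation 0 t (A^~ w)].

Definition semimartingale1 (Y : R -> Omega -> R) : Prop :=
  (forall B : set R, measurable B -> F 0 (Y 0 @^-1` B)) /\
  exists M A : R -> Omega -> R,
    [/\ local_martingale M /\ (forall w, M 0 w = 0),
        finite_variation A /\ (forall w, A 0 w = 0) &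
        forall (t : R) w, 0 <= t -> Y t w = Y 0 w + M t w + A t w].

Definition semimartingale (d : nat) (X : R -> Omega -> 'rV[R]_d) : Prop :=
  forall j : 'I_d, semimartingale1 (fun t w => X t w ord0 j).

End processes.

Section functionals.
Context {R : realType} {Omega : Type} {d q : nat}.
Variable f : Omega -> R -> 'rV[R]_d -> 'rV[R]_d -> 'rV[R]_q.

Definition is_left_value (w : Omega) (t : R) (z x : 'rV[R]_d)
    (l : 'rV[R]_q) : Prop :=
  forall (tn : nat -> R) (zn xn : nat -> 'rV[R]_d),
    (forall n, 0 <= tn n /\ tn n < t) ->
    tn @ \oo --> t -> zn @ \oo --> z -> xn @ \oo --> x ->
    f w (tn n) (zn n) (xn n) @[n --> \oo] --> l.

(* f(w, t-, z, x), unique when it exists and t > 0. *)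
Definition left_value (w : Omega) (t : R) (z x : 'rV[R]_d) : 'rV[R]_q :=
  get (is_left_value w t z x).

Definition hypK (A : set 'rV[R]_d) : Prop :=
  (forall w (t : R), 0 <= t ->
     {within [set: 'rV[R]_d] `*` A, continuous (fun u => f w t u.1 u.2)}) /\
  (forall w (t : R) z x, 0 < t -> A x -> exists l, is_left_value w t z x l).

Definition Vn (Delta : R) (X : R -> Omega -> 'rV[R]_d) (w : Omega) (t : R) :
    'rV[R]_q :=
  \sum_(1 <= i < (Num.truncn (t / Delta)).+1)
    f w (i.-1%:R * Delta) (X (i.-1%:R * Delta) w)
      (X (i%:R * Delta) w - X (i.-1%:R * Delta) w).

Definition Dterm (X : R -> Omega -> 'rV[R]_d) (w : Omega) (s : R) :
    'rV[R]_q :=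
  left_value w s (left_lim (X^~ w) s) (jump (X^~ w) s).

(* Times s in ]0, t]: there is no jump at 0, by the convention X_{0-} = X_0. *)
Definition Dsummable (X : R -> Omega -> 'rV[R]_d) (w : Omega) (t : R) : Prop :=
  forall j : 'I_q, summable `]0, t] (fun s => (Dterm X w s ord0 j)%:E).

(* The sum over the uncountable set ]0, t], coordinate by coordinate, as the
   difference of the sums of positive and negative parts; it is meaningful when
   Dsummable X w t holds. *)
Definition Dsum (X : R -> Omega -> 'rV[R]_d) (w : Omega) (t : R) : 'rV[R]_q :=
  let DX j s := Dterm X w s ord0 j in
  \row_j (fine (\esum_(s in `]0, t]) ((EFin \o DX j)^\+ s)%E)
           - fine (\esum_(s in `]0, t]) ((EFin \o DX j)^\- s)%E)).

End functionals.

(* Main.v *)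
Require Import Defs.
From HB Require Import structures.
From mathcomp Require Import all_boot all_order all_algebra.
From mathcomp Require Import all_classical all_reals all_analysis.
From mathcomp Require Import measurable_realfun ring lra.
Import Order.TTheory GRing.Theory Num.Theory.
Import numFieldNormedType.Exports.
Local Open Scope classical_set_scope.
Local Open Scope ring_scope.

Set Implicit Arguments.
Unset Strict Implicit.
Unset Printing Implicit Defensive.

(** The theorem splits into one probabilistic fact and a statement about single
    paths.

    The probabilistic fact is that almost every path of a semimartingale has
    finite [p]-variation on compacts for each [p > 2]. For a martingale [M] and
    a finite grid, follow an anchor that jumps to the current value as soon as
    it is at distance [l]. Each such reset gains [l ^ 2] in a telescoping
    sum of which the compensating part is a martingale transform, so the
    expected number of resets is of order [l ^ -2] ([resets_le_transform],
    [expectation_resets_le]). Clipping the martingale to [[-K, K]] keeps the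
    transform integrable when [M] is only integrable. Every oscillation of
    size [2 * l] forces a reset, so weighting the numbers of resets for
    [l = 2 ^- k.+1] by [2 `^ (- p)] to the power [k] dominates the
    [p]-variation; as [p > 2] the expectations are summable, and Fatou's lemma
    along the dyadic grids gives the almost sure bound
    ([finite_pvar_of_resets], [martingale_finite_pvar]). Localization and the
    total variation of the other part extend it to semimartingales
    ([semimartingale_finite_pvar]).

    Now fix a path [x] of finite [p']-variation, where [2 < p' < p]. Increments
    and jumps of size at most [eps] contribute at most a constant times
    [eps ^ (p - p')] to either sum, uniformly in the mesh
    ([small_contributions]): this gives the summability of the jump terms, and
    leaves finitely many jumps. The cell containing such a jump time [s] shrinks
    to [s], starting strictly before it, so its term tends to
    [f (s-, x_{s-}, jump at s)] by the definition of the left value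
    ([big_jump_cell_cvg]). Only the times of these terms differ: the
    approximation jumps at the end of the cell. In each cell, mark the time of
    the largest jump, and let the time change be the piecewise linear map
    sending each mark to the end of its cell ([cell_change]). It is within
    twice the mesh of the identity, and after it the approximation jumps
    exactly at the marks, hence at the same times as the limit for the large
    jumps; the remaining errors are estimated above, uniformly in time
    ([Vn_cell_change_near]). The time change does not depend on [eps], hence
    serves all tolerances at once. *)

(** * Variation over families of disjoint intervals *)

Section pvariation.
Context {R : realType}.
Implicit Types (T p C : R) (l : seq (R * R)).

(** Pairwise comparison, rather than comparison of neighbours, makes every
    subfamily of a partition admissible. *)
Definition disjoint_itvs T l : bool :=
  all (fun I => [&& 0 <= I.1, I.1 <= I.2 & I.2 <= T]) l &&
  pairwise (fun I J => I.2 <= J.1) l.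

Definition finite_pvar (V : normedModType R) p T (x : R -> V) : Prop :=
  exists C, forall l, disjoint_itvs T l ->
    \sum_(I <- l) `|x I.2 - x I.1| `^ p <= C.

Lemma disjoint_itvs_cons T I l : disjoint_itvs T (I :: l) =
  [&& 0 <= I.1, I.1 <= I.2, I.2 <= T, all (fun J => I.2 <= J.1) l &
      disjoint_itvs T l].
Proof. by rewrite /disjoint_itvs /= -!andbA; do !bool_congr. Qed.

(** The increments of the control function [g] over disjoint intervals add up to
    at most its total increment. *)
Lemma sum_disjoint_itvs_le T (phi : R * R -> R) (g : R -> R) l : 0 <= T ->
  (forall s t, 0 <= s -> s <= t -> t <= T -> g s <= g t) ->
  (forall s t, 0 <= s -> s <= t -> t <= T -> phi (s, t) <= g t - g s) ->
  disjoint_itvs T l -> \sum_(I <- l) phi I <= g T - g 0.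
Proof.
move=> T0 gnd phig.
suff H a : 0 <= a <= T -> all (fun J => a <= J.1) l -> disjoint_itvs T l ->
    \sum_(I <- l) phi I <= g T - g a.
  move=> dl; apply: (H 0) => //; first by rewrite lexx.
  by case/andP: dl => + _; apply: sub_all => I /and3P[].
elim: l a => [|[s t] l IH] a /andP[a0 aT] /=.
  by rewrite big_nil subr_ge0 gnd.
move=> /andP[as_ _]; rewrite disjoint_itvs_cons /= => /and5P[s0 st tT tl dl].
rewrite big_cons; have t0 := le_trans s0 st.
have := IH t; rewrite t0 tT => /(_ isT tl dl) {}IH.
have := phig s t s0 st tT; have := gnd a s a0 as_ (le_trans st tT).
by move: IH; lra.
Qed.

Lemma eq_finite_pvar (V : normedModType R) p T (x y : R -> V) :
  (forall t, 0 <= t <= T -> x t = y t) -> finite_pvar p T x ->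
  finite_pvar p T y.
Proof.
move=> xy [C xC]; exists C => l dl; apply: le_trans (xC _ dl).
rewrite big_seq [leRHS]big_seq le_eqVlt; apply/orP; left; apply/eqP.
apply: eq_bigr => I Il; case/andP: dl => /allP/(_ _ Il)/and3P[I0 I12 I2T] _.
by rewrite !xy ?I0 ?I2T ?(le_trans I0 I12) ?(le_trans I12 I2T).
Qed.

Lemma finite_pvarD (V : normedModType R) p T (x y : R -> V) : 0 <= p ->
  finite_pvar p T x -> finite_pvar p T y ->
  finite_pvar p T (fun t => x t + y t).
Proof.
move=> p0 [C xC] [D yD]; exists (2 `^ p * (C + D)) => l dl.
have -> : 2 `^ p * (C + D) = 2 `^ p * C + 2 `^ p * D by rewrite mulrDr.
apply: (le_trans (y := \sum_(I <- l) (2 `^ p * `|x I.2 - x I.1| `^ p +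
   2 `^ p * `|y I.2 - y I.1| `^ p))); last first.
  rewrite big_split /= -!mulr_sumr lerD// ler_wpM2l ?powR_ge0//;
  [exact: xC|exact: yD].
apply: ler_sum => I _; rewrite opprD addrACA.
set u := x I.2 - _; set v := y I.2 - _; rewrite -!powRM//.
have [uv|vu] := leP `|u| `|v|.
  apply: (@le_trans _ _ ((2 * `|v|) `^ p)); last by rewrite lerDr powR_ge0.
  apply: ge0_ler_powR; rewrite ?nnegrE ?mulr_ge0//.
  by rewrite (le_trans (ler_normD _ _))// mulr_natl mulr2n lerD.
apply: (@le_trans _ _ ((2 * `|u|) `^ p)); last by rewrite lerDl powR_ge0.
apply: ge0_ler_powR; rewrite ?nnegrE ?mulr_ge0//.
by rewrite (le_trans (ler_normD _ _))// mulr_natl mulr2n lerD// ltW.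
Qed.

Lemma finite_pvar_cst (V : normedModType R) p T (c : V) : p != 0 ->
  finite_pvar p T (fun=> c).
Proof.
move=> p0; exists 0 => l _; rewrite big1// => I _.
by rewrite subrr normr0 powR0.
Qed.

Lemma finite_pvar_row d p T (x : R -> 'rV[R]_d) : 0 < p ->
  (forall j, finite_pvar p T (fun t => x t ord0 j)) -> finite_pvar p T x.
Proof.
move=> p0 /choice[C xC]; exists (\sum_j C j) => l dl.
apply: (@le_trans _ _ (\sum_j \sum_(I <- l)
    `|x I.2 ord0 j - x I.1 ord0 j| `^ p)); last first.
  by apply: ler_sum => j _; exact: xC.
rewrite exchange_big; apply: ler_sum => I _ /=.
have [->|] := eqVneq `|x I.2 - x I.1| 0.
  by rewrite powR0 ?gt_eqF// sumr_ge0// => j _; exact: powR_ge0.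
move=> /mx_norm_neq0[[i j] /= xij]; rewrite -/(mx_norm _) in xij.
rewrite (bigD1 j)//=.
have -> : `|x I.2 - x I.1| = `|x I.2 ord0 j - x I.1 ord0 j|.
  by rewrite [LHS]xij !mxE (ord1 i).
by rewrite lerDl sumr_ge0// => k _; exact: powR_ge0.
Qed.

(** The total variation on [[0, t]] is a control function of the increments, and
    since [1 <= p] an increment bounded by [V] has [p]-th power at most
    [V ^ (p - 1)] times its size. *)
Lemma finite_pvar_bounded_variation p T (x : R -> R) : 1 <= p -> 0 <= T ->
  bounded_variation 0 T x -> finite_pvar p T x.
Proof.
move=> p1 T0 bv.
pose g t := fine (total_variation 0 t x).
have tvfin t : 0 <= t -> t <= T -> total_variation 0 t x \is a fin_num.
  by move=> t0 tT; apply/bounded_variationP => //; exact: bounded_variationl bv.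
have tvst s t : 0 <= s -> s <= t -> t <= T -> `|x t - x s| <= g t - g s.
  move=> s0 st tT; have t0 := le_trans s0 st.
  have := total_variation_ge x st; rewrite /g (total_variationD x s0 st).
  have fs := tvfin _ s0 (le_trans st tT).
  have := tvfin _ t0 tT; rewrite (total_variationD x s0 st) fin_numD.
  move=> /andP[_ ft]; rewrite fineD// addrAC subrr add0r.
  by rewrite -{1}(fineK ft) lee_fin.
have gnd s t : 0 <= s -> s <= t -> t <= T -> g s <= g t.
  move=> s0 st tT; rewrite -subr_ge0; apply: le_trans (tvst _ _ s0 st tT).
  exact: normr_ge0.
have M0 : 0 <= g T - g 0 by rewrite subr_ge0 gnd.
exists ((g T - g 0) `^ (p - 1) * (g T - g 0)) => l dl.
apply: (@le_trans _ _ (\sum_(I <- l) (g T - g 0) `^ (p - 1) *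
    `|x I.2 - x I.1|)).
  rewrite big_seq [leRHS]big_seq; apply: ler_sum => I Il.
  case/andP: dl => /allP/(_ _ Il)/and3P[I0 I12 I2T] _.
  have le1 : `|x I.2 - x I.1| <= g T - g 0.
    apply: le_trans (tvst _ _ I0 I12 I2T) _.
    by rewrite lerB// gnd ?lexx ?(le_trans I0 I12) ?(le_trans I12 I2T).
  have pE : p = (p - 1) + 1 by rewrite subrK.
  rewrite [in leLHS]pE powRD; last first.
    by apply/implyP; rewrite -pE => /eqP p0; move: p1; rewrite p0 ler10.
  by rewrite powRr1// ler_wpM2r// ge0_ler_powR ?subr_ge0 ?nnegrE.
rewrite -mulr_sumr ler_wpM2l ?powR_ge0//.
exact: (sum_disjoint_itvs_le (phi := fun I => `|x I.2 - x I.1|) T0 gnd).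
Qed.

End pvariation.

(** * Counting oscillations greedily *)

Section resets.
Context {R : realFieldType}.
Implicit Types (y m : nat -> R) (l K : R).

(** The anchor moves to the current value as soon as it is at distance [l]:
    a discrete form of the successive exit times from intervals of radius [l],
    which needs no stopping times. *)
Fixpoint anchor y l i : R :=
  if i is j.+1 then
    if l <= `|y j.+1 - anchor y l j| then y j.+1 else anchor y l j
  else y 0%N.

Fixpoint resets y l i : nat :=
  if i is j.+1 then (resets y l j + (l <= `|y j.+1 - anchor y l j|)%R)%N
  else 0%N.

Lemma dist_anchor y l i : 0 < l -> `|y i - anchor y l i| < l.
Proof.
move=> l0; case: i => [|i] /=; first by rewrite subrr normr0.
by case: ifPn => [_|]; rewrite ?subrr ?normr0 // -ltNge.
Qed.

Lemma resets_homo y l : {homo resets y l : i j / (i <= j)%N}.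
Proof.
apply: homo_leq => [n|b a c|i]; first exact: leqnn.
  exact: leq_trans.
exact: leq_addr.
Qed.

Lemma resets_eq_anchor y l i j : (i <= j)%N ->
  resets y l i = resets y l j -> anchor y l i = anchor y l j.
Proof.
elim: j => [|j IH]; first by rewrite leqn0 => /eqP ->.
rewrite leq_eqVlt => /predU1P[->//|]; rewrite ltnS => ij eij.
have cij := resets_homo y l ij.
move: eij => /=; case: ifP => _ eij; last by rewrite IH// eij addn0.
by move: cij; rewrite eij addn1 ltnn.
Qed.

(** The anchor stays within [l] of the sequence, so it has to move during any
    oscillation of size [2 * l]. *)
Lemma resets_lt y l i j : 0 < l -> (i <= j)%N -> 2 * l <= `|y j - y i| ->
  (resets y l i < resets y l j)%N.
Proof.
move=> l0 ij yij; rewrite ltn_neqAle resets_homo// andbT.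
apply/eqP => /(resets_eq_anchor ij) aij.
have := dist_anchor y i l0; have := dist_anchor y j l0; rewrite aij.
move: yij; have := ler_distD (anchor y l j) (y j) (y i).
by rewrite [`|anchor _ _ _ - y i|]distrC; lra.
Qed.

Definition clip K (a : R) : R := Num.max (- K) (Num.min K a).

Lemma clip_id K a : `|a| <= K -> clip K a = a.
Proof. by rewrite ler_norml => /andP[? ?]; rewrite /clip min_r// max_r. Qed.

Lemma clip_bound K a : 0 <= K -> `|clip K a| <= K.
Proof.
move=> K0; rewrite ler_norml /clip le_max lexx/= ge_max ge_min lexx/=.
by rewrite andbT; lra.
Qed.

Lemma clip_proj K a b : `|b| <= K -> 0 <= (clip K a - b) * (a - clip K a).
Proof.
rewrite ler_norml => /andP[Kb bK]; rewrite /clip.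
have [aK|Ka] := leP a K; last first.
  by rewrite max_r; [apply: mulr_ge0; lra|lra].
have [Ka|aK'] := leP (- K) a; first by rewrite subrr mulr0.
by apply: mulr_le0; lra.
Qed.

(** [2 c a - c ^ 2], where [c] is [a] clipped to [[-K, K]], is the convex
    function of [a] equal to [a ^ 2] on [[-K, K]] and affine with slope
    [2 * K] in absolute value outside; its Bregman divergence from the anchor
    dominates the squared distance of the clipped values, whence [l ^ 2] is
    gained at each reset, while the increments along the way telescope into a
    martingale transform. *)
Lemma resets_le_transform m l K i : 0 < l -> 0 <= K ->
  l ^+ 2 * (resets (fun j => clip K (m j)) l i)%:R <=
    2 * K * `|m i| -
    2 * \sum_(j < i) anchor (fun j => clip K (m j)) l j * (m j.+1 - m j).
Proof.
move=> l0 K0; set y := fun j => clip K (m j).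
have yK j : `|y j| <= K by exact: clip_bound.
have aK j : `|anchor y l j| <= K by elim: j => //= j IH; case: ifP.
pose phi a := 2 * clip K a * a - clip K a ^+ 2.
have phi_ge0 a : 0 <= phi a.
  have /(clip_proj a) : `|0 : R| <= K by rewrite normr0.
  by rewrite subr0 /phi; have := sqr_ge0 (clip K a); nra.
have phi_le a : phi a <= 2 * K * `|a|.
  have : clip K a * a <= K * `|a|.
    by rewrite (le_trans (ler_norm _))// normrM ler_wpM2r// clip_bound.
  by have := sqr_ge0 (clip K a); rewrite /phi -!mulrA; lra.
have breg j : (y j - anchor y l j) ^+ 2 <=
    phi (m j) - 2 * anchor y l j * m j + anchor y l j ^+ 2.
  by have := clip_proj (m j) (aK j); rewrite /phi -/(y j); nra.
have breg' j : (y j.+1 - anchor y l j) ^+ 2 <=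
    phi (m j.+1) - 2 * anchor y l j * m j.+1 + anchor y l j ^+ 2.
  by have := clip_proj (m j.+1) (aK j); rewrite /phi -/(y j.+1); nra.
suff : l ^+ 2 * (resets y l i)%:R +
    (phi (m i) - 2 * anchor y l i * m i + anchor y l i ^+ 2) <=
    phi (m i) - phi (m 0%N) - 2 * \sum_(j < i) anchor y l j * (m j.+1 - m j).
  by have := breg i; have := sqr_ge0 (y i - anchor y l i);
     have := phi_le (m i); have := phi_ge0 (m 0%N); lra.
elim: i => [|i IH].
  by rewrite big_ord0/= /phi -/(y 0%N) mulr0; lra.
rewrite big_ord_recr/= natrD; have := breg' i.
case: ifP => [lya|_] /=.
  have : l ^+ 2 <= (y i.+1 - anchor y l i) ^+ 2.
    by rewrite -[leRHS]real_normK ?num_real// ler_sqr ?nnegrE// ltW.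
  by move: IH; rewrite {4}/phi -/(y i.+1); nra.
by move: IH; rewrite addr0; lra.
Qed.

End resets.

(** * Oscillations of martingales *)

Section martingale_transform.
Context {R : realType} {disp : measure_display} {Omega : measurableType disp}.
Variables (P : probability Omega R) (F : R -> set (set Omega)).
Hypothesis hF : filtration F.
Implicit Types (s t B : R) (H D : Omega -> R) (M : R -> Omega -> R).

(** Measurability for the sigma-algebra generated by [F t], which is [F t]
    itself: the closure properties of measurable functions then apply. *)
Definition past_measurable (t : R) (H : Omega -> R) : Prop :=
  @measurable_fun _ _ (g_sigma_algebraType (F t)) R setT H.

Lemma past_measurableE t H : 0 <= t -> past_measurable t H <->
  forall B : set R, measurable B -> F t (H @^-1` B).
Proof.
move=> t0; have [/(_ _ t0)Ft _ _] := hF.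
have FE : <<s F t >> = F t by exact: sigma_algebra_id.
split=> [mH B mB|mH _ B mB].
  by have := mH measurableT B mB; rewrite setTI /measurable/= FE.
by rewrite setTI /measurable/= FE; exact: mH.
Qed.

Lemma past_measurable_le s t H : 0 <= s -> s <= t ->
  past_measurable s H -> past_measurable t H.
Proof.
move=> s0 st /(past_measurableE _ s0) mH.
apply/(past_measurableE _ (le_trans s0 st)) => B mB.
by have [_ _ /(_ _ _ s0 st)] := hF; apply; exact: mH.
Qed.

Lemma past_measurable_fun t H : 0 <= t -> past_measurable t H ->
  measurable_fun setT H.
Proof.
move=> t0 /(past_measurableE _ t0) mH _ B mB; rewrite setTI.
by have [_ /(_ _ t0) + _] := hF; apply; exact: mH.
Qed.

Lemma measurable_bounded_integrableM (H D : Omega -> R) B :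
  measurable_fun setT H -> (forall w, `|H w| <= B) ->
  P.-integrable setT (EFin \o D) ->
  P.-integrable setT (EFin \o (fun w => H w * D w)).
Proof.
move=> mH HB iD; rewrite (_ : _ \o _ = (EFin \o H) \* (EFin \o D))%E//.
apply: integrableMr => //; exists B; rewrite num_real; split => // x Bx w _ /=.
exact: le_trans (HB w) (ltW Bx).
Qed.

Lemma martingale_increment_indic M s t A : martingale P F M ->
  0 <= s -> s <= t -> F s A -> \int[P]_w (\1_A w * (M t w - M s w)) = 0.
Proof.
move=> [_ iM EM] s0 st FA; have t0 := le_trans s0 st.
have mA : measurable A by have [_ /(_ _ s0) + _] := hF; apply.
have iA r : 0 <= r -> P.-integrable A (EFin \o M r).
  by move=> r0; apply: integrableS (iM _ r0).
transitivity (\int[P]_(w in A) (M t w - M s w)).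
  rewrite [RHS]Rintegral_mkcond patch_indic; apply: eq_Rintegral => w _ /=.
  by rewrite mulrC.
by rewrite RintegralB ?iA// /Rintegral (EM s t)// subrr.
Qed.

(** A bounded past-measurable factor is a uniform limit of finite combinations
    of indicators of past events, for which the claim is the defining property
    of martingales. *)
Lemma martingale_increment_orth M s t H B : martingale P F M ->
  0 <= s -> s <= t -> past_measurable s H -> (forall w, `|H w| <= B) ->
  \int[P]_w (H w * (M t w - M s w)) = 0.
Proof.
move=> mM s0 st sH HB; have [_ iM _] := mM; have t0 := le_trans s0 st.
have mH := past_measurable_fun s0 sH.
pose D w := M t w - M s w.
have iD : P.-integrable setT (EFin \o D).
  rewrite (_ : _ \o _ = (EFin \o M t) \- (EFin \o M s))%E//.
  by apply: integrableB => //; exact: iM.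
pose X := \int[P]_w `|D w|; have X0 : 0 <= X by apply: Rintegral_ge0.
pose c := \int[P]_w (H w * D w); rewrite -/c.
suff He e : 0 < e -> `|c| <= e * X.
  apply/eqP; rewrite -normr_eq0; apply: contraT => c0.
  have cgt0 : 0 < `|c| by rewrite lt_def c0 normr_ge0.
  have X1 : 0 < X + 1 by lra.
  have := He (`|c| / (X + 1)); rewrite divr_gt0// => /(_ isT).
  by rewrite mulrAC ler_pdivlMr// mulrDr mulr1 gerDl leNgt cgt0.
move=> e0; have Bge0 : 0 <= B.
  by have [w _] : [set: Omega] !=set0 by [exists point]; apply: le_trans (HB w).
pose N := (Num.truncn (2 * B / e)).+1.
(* level sets of [H] on a grid of mesh [e] covering [[-B, B]] *)
pose A k := H @^-1` `[k%:R * e - B, k.+1%:R * e - B[.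
have FA k : F s (A k).
  by move/(past_measurableE _ s0): sH; apply; exact: measurable_itv.
have mA k : measurable (A k) by have [_ /(_ _ s0) + _] := hF; apply; exact: FA.
pose h w := \sum_(k < N) (k%:R * e - B) * \1_(A k) w.
have hH w : `|H w - h w| <= e.
  have := HB w; rewrite ler_norml => /andP[BH HB'].
  have q0 : 0 <= (H w + B) / e by apply: divr_ge0; [lra|exact: ltW].
  have kN : (Num.truncn ((H w + B) / e) < N)%N.
    by rewrite ltnS le_truncn// ler_pM2r ?invr_gt0//; lra.
  have := truncn_itv q0; rewrite ler_pdivlMr// ltr_pdivrMr// => /andP[k1 k2].
  rewrite /h (bigD1 (Ordinal kN))//= big1 => [|i ik].
    rewrite indicE mem_set ?mulr1 ?addr0; last first.
      by rewrite /A/= in_itv/=; apply/andP; split; lra.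
    rewrite ler_norml; move: k2; rewrite -natr1 mulrDl mul1r => k2.
    by apply/andP; split; lra.
  rewrite indicE memNset ?mulr0// /A/= in_itv/= => /andP[i1 i2].
  move/negP: ik; apply; apply/eqP/val_inj => /=; apply/esym/truncn_def.
  by rewrite ler_pdivlMr// ltr_pdivrMr//; apply/andP; split; lra.
have mh : measurable_fun setT h.
  by apply: measurable_sum => k; apply: measurable_funM => //;
     exact: measurable_indic.
have hB w : `|h w| <= B + e.
  by have := ler_distD (H w) (h w) 0; rewrite !subr0 distrC;
     have := hH w; have := HB w; lra.
have ihD := measurable_bounded_integrableM mh hB iD.
have iHD := measurable_bounded_integrableM mH HB iD.
have EhD : \int[P]_w (h w * D w) = 0.
  have iAD (k : nat) : P.-integrable setT (EFin \o (fun w => \1_(A k) w * D w)).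
    apply: (@measurable_bounded_integrableM _ _ 1) => //.
    by move=> w; rewrite indicE; case: (_ \in _); rewrite ?normr1 ?normr0.
  rewrite /h; elim: (N) => [|n IH].
    under eq_Rintegral do rewrite big_ord0 mul0r.
    by rewrite Rintegral_cst// mul0r.
  under eq_Rintegral do rewrite big_ord_recr/= mulrDl -mulrA.
  have iS m : P.-integrable setT (EFin \o
      (fun w => (\sum_(i < m) (i%:R * e - B) * \1_(A i) w) * D w)).
    rewrite (_ : _ \o _ = fun w => \sum_(i < m)
        ((i%:R * e - B)%:E * (\1_(A i) w * D w)%:E)%E)%E.
      by apply: integrable_sum => // i _; apply: integrableZl => //; exact: iAD.
    apply/funext => w /=; rewrite mulr_suml -sumEFin.
    by apply: eq_bigr => i _; rewrite -EFinM mulrA.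
  rewrite RintegralD//; [|exact: iS|]; last first.
    rewrite (_ : _ \o _ = fun w =>
      ((n%:R * e - B)%:E * (\1_(A n) w * D w)%:E)%E)%E//.
    by apply: integrableZl => //; exact: iAD.
  by rewrite IH add0r RintegralZl// (martingale_increment_indic mM)// mulr0.
have -> : c = \int[P]_w ((H w - h w) * D w).
  under eq_Rintegral do rewrite mulrBl.
  by rewrite RintegralB// EhD subr0.
have iHhD : P.-integrable setT (EFin \o (fun w => (H w - h w) * D w)).
  apply: (@measurable_bounded_integrableM _ _ e) => //.
  exact: measurable_funB.
apply: le_trans (le_normr_Rintegral _ iHhD) _ => //.
rewrite -RintegralZl//; last exact: integrable_norm.
apply: le_Rintegral => //; first exact: integrable_norm.
  rewrite (_ : _ \o _ = fun w => (e%:E * (`|D w|)%:E)%E)//.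
  by apply: integrableZl => //; exact: integrable_norm.
by move=> w _; rewrite normrM ler_wpM2r.
Qed.

End martingale_transform.

(** * Finite p-variation of martingales *)

Section almost_sure_bound.
Context {R : realType} {disp : measure_display} {Omega : measurableType disp}.
Variable P : probability Omega R.

(** By Fatou's lemma the limit inferior of [W] is integrable, hence finite
    almost surely. *)
Lemma ae_frequently_bounded (W : nat -> Omega -> R) (C : R) :
  (forall m w, 0 <= W m w) ->
  (forall m, P.-integrable setT (EFin \o W m)) ->
  (forall m, \int[P]_w W m w <= C) ->
  {ae P, forall w, exists L, forall N, exists2 m, (N <= m)%N & W m w <= L}.
Proof.
move=> W0 iW WC.
have mW m : measurable_fun setT (EFin \o W m) := measurable_int _ (iW m).
have W0e m w : [set: Omega] w -> (0 <= (EFin \o W m) w)%E.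
  by move=> _; rewrite lee_fin.
pose g w := limn_einf (fun m => (W m w)%:E).
have g0 w : (0 <= g w)%E.
  rewrite /g limn_einf_lim; apply: lime_ge; first exact: is_cvg_einfs.
  by apply: nearW => m; apply: le_ereal_inf_tmp => _ [k _ <-]; rewrite lee_fin.
have mg : measurable_fun setT g.
  rewrite (_ : g = fun w => limn (einfs (fun m => (W m w)%:E))); last first.
    by apply/funext => w; rewrite /g limn_einf_lim.
  apply: (emeasurable_fun_cvg (fun N w => einfs (fun m => (W m w)%:E) N)).
    by move=> N; exact: (measurable_fun_einfs mW).
  by move=> w _; exact: is_cvg_einfs.
have ig : P.-integrable setT g.
  apply/integrableP; split=> //; under eq_integral do rewrite gee0_abs//.
  apply: (@le_lt_trans _ _ C%:E); last exact: ltry.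
  apply: le_trans (fatou P measurableT mW W0e) _.
  rewrite limn_einf_lim; apply: lime_le; first exact: is_cvg_einfs.
  apply: nearW => N; apply: ge_ereal_inf; exists (\int[P]_w (W N w)%:E)%E.
    by exists N => //=.
  have fW : (\int[P]_w (W N w)%:E)%E \is a fin_num.
    exact: (integrable_fin_num _ (iW N)).
  by rewrite -(fineK fW) lee_fin; exact: WC.
have := integrable_ae measurableT ig.
apply: filterS => w /(_ I); case gw : (g w) => [c||]// _.
exists (c + 1) => N; apply: contrapT => noW.
have : (g w >= (c + 1)%:E)%E.
  rewrite /g limn_einf_lim; apply: lime_ge; first exact: is_cvg_einfs.
  exists N => // n /= Nn; apply: le_ereal_inf_tmp => _ [k /= nk <-].
  rewrite leNgt; apply/negP; rewrite lte_fin => /ltW Wk; apply: noW.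
  by exists k => //; exact: leq_trans nk.
by rewrite gw lee_fin gerDl ler10.
Qed.

End almost_sure_bound.

Section resets_expectation.
Context {R : realType} {disp : measure_display} {Omega : measurableType disp}.
Variables (P : probability Omega R) (F : R -> set (set Omega)).
Hypothesis hF : filtration F.
Variable M : R -> Omega -> R.
Hypothesis mM : martingale P F M.
Variables (tau : nat -> R) (l K : R).
Hypotheses (tau0 : forall i, 0 <= tau i) (tauS : forall i, tau i <= tau i.+1).
Hypotheses (l0 : 0 < l) (K0 : 0 <= K).

Let y w j := clip K (M (tau j) w).

Let past_y j : past_measurable F (tau j) (y^~ j).
Proof.
have [aM _ _] := mM; apply: measurable_maxr => //; apply: measurable_minr => //.
by apply/past_measurableE => // B mB; exact: aM.
Qed.

Let past_anchor i : past_measurable F (tau i) (fun w => anchor (y w) l i).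
Proof.
elim: i => [|i IH]; first exact: past_y.
have IH' := past_measurable_le hF (tau0 i) (tauS i) IH.
apply: measurable_fun_ifT; [|exact: past_y|exact: IH'].
apply: measurable_fun_ler; first exact: measurable_cst.
by apply: measurableT_comp => //; apply: measurable_funB; [exact: past_y|].
Qed.

Let measurable_resets i :
  measurable_fun setT (fun w => (resets (y w) l i)%:R : R).
Proof.
have my j := past_measurable_fun hF (tau0 j) (@past_y j).
have ma j := past_measurable_fun hF (tau0 j) (@past_anchor j).
elim: i => [|i IH]; first exact: measurable_cst.
under eq_fun do rewrite natrD; apply: measurable_funD => //.
rewrite (_ : (fun w => _) = fun w =>
  if l <= `|y w i.+1 - anchor (y w) l i| then 1 else 0); last first.
  by apply/funext => w; case: ifP.
apply: measurable_fun_ifT => //; apply: measurable_fun_ler => //.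
by apply: measurableT_comp => //; exact: measurable_funB.
Qed.

Lemma integrable_resets i :
  P.-integrable setT (EFin \o (fun w => (resets (y w) l i)%:R : R)).
Proof.
apply: measurable_bounded_integrable => //.
  by rewrite (le_lt_trans (probability_le1 _ _))// ltry.
exists i%:R; rewrite num_real; split => // x ix w _ /=.
rewrite ger0_norm// (le_trans _ (ltW ix))// ler_nat.
elim: i {ix} => //= i IH; rewrite -addn1 leq_add//.
by case: (l <= _).
Qed.

(** In the pathwise bound on the number of resets, the martingale transform has
    zero expectation: each anchor is bounded by [K] and known at the start of
    the step that it multiplies. *)
Lemma expectation_resets_le i :
  l ^+ 2 * (\int[P]_w (resets (y w) l i)%:R) <=
  2 * K * \int[P]_w `|M (tau i) w|.
Proof.
have [_ iM _] := mM.
pose Z n w := \sum_(j < n) anchor (y w) l j * (M (tau j.+1) w - M (tau j) w).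
have aB w j : `|anchor (y w) l j| <= K.
  elim: j => [|j IH] /=; first exact: clip_bound.
  by case: ifP => // _; exact: clip_bound.
have iD j :
    P.-integrable setT (EFin \o (fun w => M (tau j.+1) w - M (tau j) w)).
  rewrite (_ : _ \o _ = (EFin \o M (tau j.+1)) \- (EFin \o M (tau j)))%E//.
  by apply: integrableB => //; exact: iM.
have iA j : P.-integrable setT
    (EFin \o (fun w => anchor (y w) l j * (M (tau j.+1) w - M (tau j) w))).
  apply: (@measurable_bounded_integrableM _ _ _ _ _ _ K) => //.
  exact: (past_measurable_fun hF (tau0 j) (@past_anchor j)).
have [iZ EZ] : P.-integrable setT (EFin \o Z i) /\ \int[P]_w Z i w = 0.
  elim: (i) => [|n [iZ EZ]].
    have Z0 : Z 0%N = cst 0 by apply/funext => w; rewrite /Z big_ord0.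
    rewrite Z0 Rintegral_cst// mul0r; split => //; exact: integrable0.
  have ZS : Z n.+1 = fun w => Z n w +
      anchor (y w) l n * (M (tau n.+1) w - M (tau n) w).
    by apply/funext => w; rewrite /Z big_ord_recr.
  rewrite ZS RintegralD// EZ add0r; split.
    rewrite (_ : _ \o _ = (EFin \o Z n) \+ (EFin \o (fun w =>
      (anchor (y w) l n * (M (tau n.+1) w - M (tau n) w))%R)))%E//.
    by apply: integrableD => //; exact: iA.
  exact: (martingale_increment_orth hF mM (tau0 n) (tauS n) (@past_anchor n)).
have iaM : P.-integrable setT (EFin \o (fun w => `|M (tau i) w|)).
  by apply: integrable_norm; exact: iM.
have iKM : P.-integrable setT (EFin \o (fun w => 2 * K * `|M (tau i) w|)).
  rewrite (_ : _ \o _ = fun w => (2 * K)%:E * (`|M (tau i) w|%R)%:E)%E//.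
  exact: integrableZl.
have i2Z : P.-integrable setT (EFin \o (fun w => 2 * Z i w)).
  rewrite (_ : _ \o _ = fun w => 2%:E * (Z i w)%:E)%E//.
  exact: integrableZl.
rewrite -RintegralZl//; last exact: integrable_resets.
apply: (@le_trans _ _ (\int[P]_w (2 * K * `|M (tau i) w| - 2 * Z i w))).
  apply: le_Rintegral => //.
  - rewrite (_ : _ \o _ = fun w => (l ^+ 2)%:E * (resets (y w) l i)%:R%:E)%E//.
    by apply: integrableZl => //; exact: integrable_resets.
  - rewrite (_ : _ \o _ = (EFin \o (fun w => 2 * K * `|M (tau i) w|)%R) \-
      (EFin \o (fun w => 2 * Z i w)%R))%E//.
    exact: integrableB.
  - by move=> w _; exact: (resets_le_transform (fun j => M (tau j) w)).
by rewrite RintegralB// !RintegralZl// EZ mulr0 subr0.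
Qed.

End resets_expectation.

Section powR_limits.
Context {R : realType}.

Lemma cvg_powR (T : Type) (G : set_system T) {FG : Filter G} (u : T -> R)
    (a p : R) : 0 < p -> (forall x, 0 <= u x) -> 0 <= a ->
  u @ G --> a -> (u x) `^ p @[x --> G] --> a `^ p.
Proof.
move=> p0 u0; rewrite le_eqVlt => /predU1P[<-|a0] ua.
  rewrite powR0 ?gt_eqF//; apply/cvgrPdist_lt => e e0.
  have ep : 0 < e `^ p^-1 by exact: powR_gt0.
  move/cvgrPdist_lt : ua => /(_ _ ep); apply: filterS => x.
  rewrite !sub0r !normrN ger0_norm// ger0_norm ?powR_ge0// => ux.
  have -> : e = (e `^ p^-1) `^ p.
    by rewrite -powRrM mulVf ?gt_eqF// powRr1// ltW.
  by apply: gt0_ltr_powR; rewrite ?nnegrE ?powR_ge0.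
have /derivable1_diffP/differentiable_continuous cp :
    derivable (fun y : R => y `^ p) a 1.
  by apply: derivable_powR; rewrite in_itv/= a0.
exact: cvg_comp ua cp.
Qed.

Lemma cvg_at_right_seq (u : nat -> R) (a : R) : (forall n, a < u n) ->
  u @ \oo --> a -> u @ \oo --> a^'+.
Proof.
move=> au ua A aA; have := ua _ aA; rewrite /nbhs/=.
by apply: filterS => n /(_ (au n)).
Qed.

Lemma limit_le_frequently (u : nat -> R) (a B : R) : u @ \oo --> a ->
  (forall N, exists2 m, (N <= m)%N & u m <= B) -> a <= B.
Proof.
move=> ua uB; rewrite leNgt; apply/negP => Ba.
have [N _ NB] : \forall n \near \oo, B < u n by exact: cvgr_gt ua _ Ba.
by have [m Nm] := uB N; rewrite leNgt NB.
Qed.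

End powR_limits.

Section resets_pvariation.
Context {R : realType}.

(** Decomposing increments dyadically by size, the increments of size about
    [2 ^- k] are at most as many as the resets with threshold [2 ^- k.+1].
    Only the limit inferior of the weighted sum of the numbers of resets along
    the dyadic grids has to be controlled, since those of a finer grid need not
    be the larger ones. *)
Lemma finite_pvar_of_resets (x : R -> R) (p K L : R) (T : nat) : 0 < p ->
  (forall t, 0 <= t -> x s @[s --> t^'+] --> x t) ->
  (forall t, 0 <= t <= T.+1%:R -> `|x t| <= K) ->
  (forall N, exists2 m, (N <= m)%N &
    \sum_(k < m) (2^-1 `^ p) ^+ k *
      (resets (fun i => clip K (x (i%:R / 2 ^+ m))) (2 ^- k.+1)
        (T.+1 * 2 ^ m))%:R <= L) ->
  finite_pvar p T%:R x.
Proof.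
move=> p0 rx xK hL.
have K0 : 0 <= K by apply: le_trans (xK 0 _); rewrite ?lexx/=.
pose r : R := 2^-1 `^ p; have r0 : 0 < r by rewrite powR_gt0.
have r1 : r < 1.
  have -> : 1 = 1 `^ p :> R by rewrite powR1.
  apply: gt0_ltr_powR; rewrite ?nnegrE//; lra.
(* [2 `^ p] serves the increments below 1, [(2 * K) `^ p] the others *)
pose A := 2 `^ p + (2 * K) `^ p.
have A0 : 0 <= A by rewrite addr_ge0// powR_ge0.
have pow2 k : 0 < 2 ^+ k :> R by rewrite exprn_gt0.
pose c m k i := resets (fun i => clip K (x (i%:R / 2 ^+ m))) (2 ^- k.+1) i.
(* rounding strictly to the right, so that right continuity applies *)
pose rd (m : nat) (t : R) := (Num.truncn (t * 2 ^+ m)).+1.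
pose rho m t : R := (rd m t)%:R / 2 ^+ m.
have rdle m s t : s <= t -> (rd m s <= rd m t)%N.
  by move=> st; rewrite ltnS le_truncn// ler_pM2r.
have rho_gt m t : t < rho m t by rewrite /rho ltr_pdivlMr// truncnS_gt.
have rho_le m t : 0 <= t -> rho m t <= t + 2 ^- m.
  move=> t0; rewrite /rho ler_pdivrMr// mulrDl mulVf ?gt_eqF//.
  by rewrite /rd -natr1 lerD2r truncn_le mulr_ge0// ltW.
have rdT m t : t <= T%:R -> (rd m t <= T.+1 * 2 ^ m)%N.
  move=> tT; apply: (leq_trans (rdle m _ _ tT)).
  rewrite /rd -natrX -natrM natrK mulSn -add1n leq_add2r expn_gt0//.
have rhoT m t : 0 <= t -> t <= T%:R -> 0 <= rho m t <= T.+1%:R.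
  move=> t0 tT; rewrite (le_trans t0 (ltW (rho_gt m t)))/= /rho ler_pdivrMr//.
  by rewrite -natrX -natrM ler_nat rdT.
exists (A * L) => l dl.
pose u m := \sum_(I <- l) `|x (rho m I.2) - x (rho m I.1)| `^ p.
pose v m := u m - (size l)%:R * (A * r ^+ m).
have l0 I : I \in l -> 0 <= I.1 /\ 0 <= I.2.
  move=> Il; case/andP: dl => /allP/(_ _ Il)/and3P[I0 I12 _] _.
  by split => //; exact: le_trans I12.
have cvx t : 0 <= t -> x (rho m t) @[m --> \oo] --> x t.
  move=> t0; apply: cvg_comp (rx t t0).
  apply: cvg_at_right_seq => // .
  apply: (@squeeze_cvgr _ _ _ _ (cst t) (fun m => t + 2 ^- m)).
  - by apply: nearW => m; rewrite ltW ?rho_gt//= rho_le.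
  - exact: cvg_cst.
  - rewrite -[X in _ --> X]addr0; apply: cvgD; first exact: cvg_cst.
    under eq_fun do rewrite -exprVn.
    by apply: cvg_expr; rewrite ger0_norm; lra.
have cvu : u @ \oo --> \sum_(I <- l) `|x I.2 - x I.1| `^ p.
  rewrite /u; elim: (l) l0 => [|I l' IH] l0.
    by under eq_fun do rewrite big_nil; rewrite big_nil; exact: cvg_cst.
  under eq_fun do rewrite big_cons; rewrite big_cons; apply: cvgD; last first.
    by apply: IH => J Jl; apply: l0; rewrite inE Jl orbT.
  have [I1 I2] := l0 _ (mem_head _ _).
  apply: cvg_powR => //; apply: cvg_norm; apply: cvgB; exact: cvx.
have cvv : v @ \oo --> \sum_(I <- l) `|x I.2 - x I.1| `^ p.
  rewrite -[X in _ --> X]subr0; apply: cvgB => //.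
  rewrite -[X in _ --> X](mulr0 (size l)%:R); apply: cvgMl_tmp.
  rewrite -[X in _ --> X](mulr0 A); apply: cvgMl_tmp.
  by apply: cvg_expr; rewrite ger0_norm ?ltW.
apply: limit_le_frequently cvv _ => N; have [m Nm mL] := hL N.
exists m => //.
(* [A * r ^+ m] absorbs the increments too small for the first [m] thresholds *)
pose g t := A * \sum_(k < m) r ^+ k * (c m k (rd m t))%:R.
have gnd s t : 0 <= s -> s <= t -> t <= T%:R -> g s <= g t.
  move=> s0 st tT; rewrite ler_wpM2l//; apply: ler_sum => k _.
  by rewrite ler_wpM2l ?exprn_ge0 ?(ltW r0)// ler_nat resets_homo// rdle.
have gphi s t : 0 <= s -> s <= t -> t <= T%:R ->
    `|x (rho m t) - x (rho m s)| `^ p - A * r ^+ m <= g t - g s.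
  move=> s0 st tT; set dx := `|_|; have dx0 : 0 <= dx by exact: normr_ge0.
  have xs := xK _ (rhoT m s s0 (le_trans st tT)).
  have xt := xK _ (rhoT m t (le_trans s0 st) tT).
  have dxK : dx <= 2 * K.
    by rewrite (le_trans (ler_normB _ _))// mulr_natl mulr2n lerD.
  have ex : exists k, (k == m) || (2 ^- k <= dx) by exists m; rewrite eqxx.
  have [k /= km kmin] := ex_minnP ex.
  have dxAk : dx `^ p <= A * r ^+ k.
    case: k km kmin => [_ _|k km kmin].
      rewrite expr0 mulr1; apply: (@le_trans _ _ ((2 * K) `^ p)).
        by apply: ge0_ler_powR; rewrite ?nnegrE ?mulr_ge0 ?(ltW p0)//.
      by rewrite lerDr powR_ge0.
    have dxk : dx <= 2 * 2 ^- k.+1.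
      rewrite exprS invfM mulVKf//.
      case: (leP dx (2 ^- k)) => // /ltW dxk.
      by have := kmin k; rewrite dxk orbT ltnn => /(_ isT).
    apply: (@le_trans _ _ (2 `^ p * r ^+ k.+1)); last first.
      by rewrite ler_wpM2r ?exprn_ge0 ?(ltW r0)// lerDl powR_ge0.
    rewrite /r -powR_mulrn ?powR_ge0// powRAC powR_mulrn ?invr_ge0//.
    rewrite -powRM ?exprn_ge0 ?invr_ge0// exprVn.
    by apply: ge0_ler_powR; rewrite ?nnegrE ?mulr_ge0 ?invr_ge0 ?(ltW p0)// ltW.
  case/predU1P: km kmin dxAk => [->|kdx] kmin dxAk.
    by have := gnd s t s0 st tT; move: dxAk; lra.
  have [km|mk] := ltnP k m; last first.
    have <- : k = m by apply/eqP; rewrite eqn_leq mk kmin// eqxx.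
    by have := gnd s t s0 st tT; move: dxAk; lra.
  apply: (@le_trans _ _ (dx `^ p)).
    by rewrite gerBl mulr_ge0// exprn_ge0// ltW.
  apply: le_trans dxAk _; rewrite -mulrBr ler_wpM2l// -sumrB.
  rewrite (bigD1 (Ordinal km))//= -[leLHS]addr0 lerD//; last first.
    apply: sumr_ge0 => j _; rewrite -mulrBr mulr_ge0 ?exprn_ge0 ?(ltW r0)//.
    by rewrite subr_ge0 ler_nat resets_homo// rdle.
  rewrite -mulrBr -[leLHS]mulr1 ler_wpM2l ?exprn_ge0 ?(ltW r0)//.
  rewrite lerBrDr nat1r ler_nat; apply: resets_lt.
  - by rewrite invr_gt0.
  - exact: rdle.
  - rewrite !clip_id//; rewrite exprS invfM mulVKf//.
have T0 : 0 <= T%:R :> R by [].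
have := sum_disjoint_itvs_le (phi := fun I =>
  `|x (rho m I.2) - x (rho m I.1)| `^ p - A * r ^+ m) T0 gnd gphi dl.
rewrite sumrB -/(u m) big_const_seq count_predT iter_addr addr0.
rewrite -[A * _ *+ _]mulr_natl -/(v m) => /le_trans -> //.
apply: (@le_trans _ _ (g T%:R)).
  rewrite gerBl mulr_ge0// sumr_ge0// => k _.
  by rewrite mulr_ge0// exprn_ge0// ltW.
rewrite ler_wpM2l//; apply: le_trans mL; apply: ler_sum => k _.
by rewrite ler_wpM2l ?exprn_ge0 ?(ltW r0)// ler_nat resets_homo// rdT.
Qed.

End resets_pvariation.

(** * Càdlàg paths *)

Section cadlag_paths.
Context {R : realType}.

Lemma near_from_sides (t : R) (Q : R -> Prop) :
  (\forall s \near t^'-, Q s) -> (\forall s \near t^'+, Q s) -> Q t ->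
  \forall s \near t, Q s.
Proof.
rewrite !near_withinE => Ql Qr Qt; apply: filterS2 Ql Qr => s Ql Qr.
by have [/Ql|/Qr|->] := ltgtP s t.
Qed.

Lemma eq_cadlag {E : uniformType} (x y : R -> E) :
  (forall t, 0 <= t -> x t = y t) -> cadlag x -> cadlag y.
Proof.
move=> xy [rx lx]; split => [t t0|t t0].
  rewrite -xy//; apply: cvg_trans (rx t t0).
  by apply: near_eq_cvg; near=> s; rewrite xy// (le_trans t0)// ltW.
have [l xl] := lx t t0; exists l; apply: cvg_trans xl.
apply: near_eq_cvg; near=> s; rewrite xy//; apply: ltW.
by near: s; exact: nbhs_left_gt.
Unshelve. all: by end_near. Qed.

Lemma cadlag_bounded {V : normedModType R} (x : R -> V) (T : R) :
  cadlag x -> exists K, forall t, 0 <= t <= T -> `|x t| <= K.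
Proof.
move=> [rx lx].
have /compact_near_coveringP cov := @segment_compact R 0 T.
have H : forall t, `[0, T]%classic t ->
    \forall t' \near t & K \near +oo, 0 <= t' -> `|x t'| <= K.
  move=> t; rewrite /= in_itv/= => /andP[t0 _].
  suff [K0 HK] : exists K0, \forall s \near t, 0 <= s -> `|x s| <= K0.
    exists ([set s | 0 <= s -> `|x s| <= K0], [set K | K0 <= K]).
      by split => //=; apply: nbhs_pinfty_ge; exact: num_real.
    by move=> [s K] [/= sK K0K] s0; exact: le_trans (sK s0) K0K.
  have bnd (l : V) (G : set_system R) (FG : Filter G) : x s @[s --> G] --> l ->
      \forall s \near G, 0 <= s -> `|x s| <= `|l| + 1.
    move=> xl; have : \forall s \near G, `|l - x s| < 1.
      by move/cvgrPdist_lt : xl; apply.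
    apply: filterS => s ls _.
    by have := ler_distD l (x s) 0; rewrite !subr0 distrC; move: ls; lra.
  have Hr : \forall s \near t^'+, 0 <= s -> `|x s| <= `|x t| + 1.
    exact: bnd (rx t t0).
  move: t0; rewrite le_eqVlt => /predU1P[t0|t0].
    exists (`|x t| + 1); apply: near_from_sides => //; last by rewrite lerDl.
    rewrite -t0; near=> s => s0; suff : s < 0 by rewrite ltNge s0.
    by near: s; exact: nbhs_left_lt.
  have [l xl] := lx t t0.
  have Hl : \forall s \near t^'-, 0 <= s -> `|x s| <= `|l| + 1 by exact: bnd xl.
  exists (`|x t| + 1 + (`|l| + 1)); apply: near_from_sides.
  - by apply: filterS Hl => s H /H; have := normr_ge0 (x t); lra.
  - by apply: filterS Hr => s H /H; have := normr_ge0 l; lra.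
  - by have := normr_ge0 l; lra.
have [K [_ KT]] := cov R +oo (fun K t => 0 <= t -> `|x t| <= K) _ H.
exists (K + 1) => t /andP[t0 tT].
by apply: (KT (K + 1)); rewrite ?ltrDl//= in_itv/= t0.
Unshelve. all: by end_near. Qed.

Lemma cadlag_stopped {E : uniformType} (x : R -> E) (T : \bar R) :
  (0 <= T)%E -> cadlag x -> cadlag (fun t => x (fine (mine t%:E T))).
Proof.
case: T => [r r0 [rx lx]|_|//]; last first.
  by apply: eq_cadlag => t _; rewrite min_l// leey.
rewrite lee_fin in r0.
have -> : (fun t => x (fine (mine t%:E r%:E))) = (fun t => x (Num.min t r)).
  by apply/funext => t; rewrite -EFin_min.
split=> t t0.
  have [tr|rt] := ltP t r.
    apply: cvg_trans (rx t t0); apply: near_eq_cvg; near=> s.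
    by rewrite min_l// ltW.
  apply: cvg_near_cst; near=> s.
  by rewrite min_r// (le_trans rt)// ltW.
have [tr|rt] := leP t r.
  have [l xl] := lx t t0; exists l; apply: cvg_trans xl.
  by apply: near_eq_cvg; near=> s; rewrite min_l// (le_trans _ tr)// ltW.
exists (x r); apply: cvg_near_cst; near=> s.
by rewrite min_r// ltW.
Unshelve. all: by end_near. Qed.

Lemma cadlagD {V : normedModType R} (x y : R -> V) :
  cadlag x -> cadlag y -> cadlag (fun t => x t + y t).
Proof.
move=> [rx lx] [ry ly]; split => t t0; first exact: cvgD (rx t t0) (ry t t0).
have [l xl] := lx t t0; have [m ym] := ly t t0; exists (l + m); exact: cvgD.
Qed.

Lemma cadlag_cst {E : uniformType} (c : E) : cadlag (fun _ : R => c).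
Proof. by split=> t _; [|exists c]; exact: cvg_cst. Qed.

Lemma cvg_row {d : nat} (T : Type) (G : set_system T) {FG : Filter G}
    (u : T -> 'rV[R]_d) (l : 'rV[R]_d) :
  (forall j, u x ord0 j @[x --> G] --> l ord0 j) -> u @ G --> l.
Proof.
move=> ul; apply/cvgrPdist_le => e e0.
have : \forall x \near G, forall j, `|l ord0 j - u x ord0 j| <= e.
  apply: filter_forall => j.
  by move/cvgrPdist_le : (ul j) => /(_ e e0).
apply: filterS => x lu; rewrite [leLHS]mx_normrE.
by apply: bigmax_le; [exact: ltW|move=> [i j] _; rewrite !mxE (ord1 i)].
Qed.

Lemma cadlag_row {d : nat} (x : R -> 'rV[R]_d) :
  (forall j, cadlag (fun t => x t ord0 j)) -> cadlag x.
Proof.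
move=> cx; split=> t t0.
  by apply: cvg_row => j; have [rx _] := cx j; exact: rx.
have lx j : exists l : R, x s ord0 j @[s --> t^'-] --> l.
  by have [_ lx] := cx j; exact: lx.
have [l xl] := choice lx.
by exists (\row_j l j); apply: cvg_row => j; rewrite mxE.
Qed.

End cadlag_paths.

(** * p-variation of semimartingales *)

Section semimartingale_pvariation.
Context {R : realType} {disp : measure_display} {Omega : measurableType disp}.
Variables (P : probability Omega R) (F : R -> set (set Omega)).
Hypothesis hF : filtration F.

(** The expected number of resets with threshold [2 ^- k.+1] is of order
    [4 ^ k], and the weights [2 `^ (- p)] to the power [k] make these numbers
    summable because [2 < p]. The bound concerns the clipped martingale, which
    is the martingale itself along the paths bounded by [K]; every càdlàg path
    is bounded on compacts, hence covered by some integer [K]. *)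
Lemma martingale_finite_pvar (M : R -> Omega -> R) (p : R) (T : nat) :
  martingale P F M -> (forall w, cadlag (M^~ w)) -> 2 < p ->
  {ae P, forall w, finite_pvar p T%:R (M^~ w)}.
Proof.
move=> mM cM p2; have p0 : 0 < p by lra.
have [_ iM _] := mM.
suff : forall K : nat, {ae P, forall w,
    (forall t, 0 <= t <= T.+1%:R -> `|M t w| <= K%:R) ->
    finite_pvar p T%:R (M^~ w)}.
  move=> /ae_foralln; apply: filterS => w H.
  (* up to [T.+1]: rounding the times to the right may leave [[0, T]] *)
  have [K MK] := cadlag_bounded T.+1%:R (cM w).
  apply: (H (Num.truncn K).+1) => t /MK MtK.
  exact: le_trans MtK (ltW (truncnS_gt _)).
move=> K.
pose r : R := 2^-1 `^ p; have r0 : 0 < r by rewrite powR_gt0.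
have r4 : 4 * r < 1.
  have -> : r = 2^-1 ^+ 2 * 2^-1 `^ (p - 2).
    have pE : p = 2%:R + (p - 2) by rewrite addrC subrK.
    rewrite /r {1}pE [LHS]powRD; last first.
      by apply/implyP; rewrite invr_eq0 pnatr_eq0.
    by rewrite powR_mulrn// invr_ge0.
  have : 2^-1 `^ (p - 2) < 1 `^ (p - 2) :> R.
    by apply: gt0_ltr_powR; rewrite ?nnegrE//; lra.
  by rewrite powR1; lra.
pose y m w (i : nat) := clip K%:R (M (i%:R / 2 ^+ m) w).
pose N m w k : R := (resets (y m w) (2 ^- k.+1) (T.+1 * 2 ^ m))%:R.
pose W m w := \sum_(k < m) r ^+ k * N m w k.
pose C := 8 * K%:R * \int[P]_w `|M T.+1%:R w|.
have pow2 k : 0 < 2 ^+ k :> R by rewrite exprn_gt0.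
have tau0 m i : 0 <= i%:R / 2 ^+ m :> R by rewrite divr_ge0// ltW.
have tauS m i : i%:R / 2 ^+ m <= i.+1%:R / 2 ^+ m :> R.
  by rewrite ler_pM2r ?invr_gt0// ler_nat.
have iN m k : P.-integrable setT (EFin \o (fun w => N m w k)).
  exact: (integrable_resets hF mM _ _ (tau0 m) (tauS m)).
have EN m k : \int[P]_w N m w k <= C * 4 ^+ k.
  have l0 : 0 < 2 ^- k.+1 :> R by rewrite invr_gt0.
  have := expectation_resets_le hF mM (tau0 m) (tauS m) l0 (ler0n R K)
    (T.+1 * 2 ^ m)%N.
  rewrite natrM natrX mulfK ?gt_eqF//.
  have -> : (2 ^- k.+1) ^+ 2 = (4 * 4 ^+ k)^-1 :> R.
    have -> : 4 = 2 ^+ 2 :> R by rewrite expr2; lra.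
    by rewrite exprVn -exprM -exprM -exprD mulnC mulnS.
  rewrite mulrC ler_pdivrMr ?mulr_gt0 ?exprn_gt0// => /le_trans; apply.
  by rewrite /C le_eqVlt; apply/orP; left; apply/eqP; ring.
have iWk m n : P.-integrable setT
    (EFin \o (fun w => \sum_(k < n) r ^+ k * N m w k)).
  rewrite (_ : _ \o _ = fun w => \sum_(k < n) (r ^+ k)%:E * (N m w k)%:E)%E.
    by apply: integrable_sum => // k _; apply: integrableZl => //; exact: iN.
  by apply/funext => w /=; rewrite -sumEFin; apply: eq_bigr.
have C0 : 0 <= C by rewrite !mulr_ge0//; exact: Rintegral_ge0.
have EW m n : \int[P]_w (\sum_(k < n) r ^+ k * N m w k) <=
    C * \sum_(k < n) (4 * r) ^+ k.
  elim: n => [|n IH].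
    under eq_Rintegral do rewrite big_ord0.
    by rewrite Rintegral_cst// mul0r big_ord0 mulr0.
  under eq_Rintegral do rewrite big_ord_recr/=.
  rewrite RintegralD//; [|exact: iWk|]; last first.
    rewrite (_ : _ \o _ = fun w => (r ^+ n)%:E * (N m w n)%:E)%E//.
    by apply: integrableZl => //; exact: iN.
  have -> : \int[P]_w (r ^+ n * N m w n) = r ^+ n * \int[P]_w N m w n.
    by apply: RintegralZl => //; exact: iN.
  rewrite big_ord_recr/= mulrDr lerD//.
  apply: le_trans (ler_wpM2l _ (EN m n)) _; first by rewrite exprn_ge0// ltW.
  by rewrite exprMn le_eqVlt; apply/orP; left; apply/eqP; ring.
have WC m : \int[P]_w W m w <= C / (1 - 4 * r).
  apply: le_trans (EW m m) _; rewrite ler_wpM2l//.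
  rewrite -[leRHS]mul1r ler_pdivlMr; last lra.
  have := subrX1 (4 * r) m; have : 0 <= (4 * r) ^+ m.
    by rewrite exprn_ge0// mulr_ge0// ltW.
  by rewrite mulrC; nra.
have W0 m w : 0 <= W m w.
  by apply: sumr_ge0 => k _; rewrite mulr_ge0// exprn_ge0// ltW.
have := ae_frequently_bounded W0 (fun m => iWk m m) WC.
apply: filterS => w [L hL] MK.
by apply: (finite_pvar_of_resets p0 (cM w).1 MK (L := L)).
Qed.

Lemma local_martingale_finite_pvar (M : R -> Omega -> R) (p : R) :
  local_martingale P F M -> 2 < p ->
  {ae P, forall w, forall T : nat, finite_pvar p T%:R (M^~ w)}.
Proof.
move=> [_ cM [tau [stau aetau] mtau]] p2.
have aes : {ae P, forall w, forall n T : nat,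
    finite_pvar p T%:R (fun t => stopped M (tau n) t w)}.
  apply/ae_foralln => n; apply/ae_foralln => T.
  apply: martingale_finite_pvar => // w; apply: cadlag_stopped (cM w).
  by have [+ _] := stau n; apply.
apply: filterS2 aetau aes => w [_ tauy] H T.
have [n Tn] : exists n, (T%:R%:E <= tau n w)%E.
  have /cvgeyPge/(_ T%:R)[n _ Hn] := tauy.
  by exists n; exact: (Hn n (leqnn n)).
apply: eq_finite_pvar (H n T) => t /andP[t0 tT].
by rewrite /stopped min_l// (le_trans _ Tn)// lee_fin.
Qed.

Lemma semimartingale_cadlag d (X : R -> Omega -> 'rV[R]_d) :
  semimartingale P F X -> forall w, cadlag (X^~ w).
Proof.
move=> sX w; apply: cadlag_row => j.
have [_ [M [A [[[_ cM _] _] [[_ cA _] _] XE]]]] := sX j.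
apply: (@eq_cadlag _ _ (fun t => X 0 w ord0 j + M t w + A t w)).
  by move=> t t0; exact/esym/XE.
by do 2 apply: cadlagD => //; exact: cadlag_cst.
Qed.

Lemma semimartingale_finite_pvar d (X : R -> Omega -> 'rV[R]_d) (p : R) :
  semimartingale P F X -> 2 < p ->
  {ae P, forall w, forall T : nat, finite_pvar p T%:R (X^~ w)}.
Proof.
move=> sX p2; have p0 : 0 < p by lra.
suff H : {ae P, forall w, forall (j : 'I_d) (T : nat),
    finite_pvar p T%:R (fun t => X t w ord0 j)}.
  by apply: filterS H => w H T; apply: finite_pvar_row.
apply: filter_forall => j.
have [_ [M [A [[lM _] [[_ _ bA] _] XE]]]] := sX j.
have := local_martingale_finite_pvar lM p2; apply: filterS => w MT T.
apply: (@eq_finite_pvar _ _ _ _ (fun t => X 0 w ord0 j + M t w + A t w)).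
  by move=> t /andP[t0 _]; exact/esym/XE.
apply: finite_pvarD; [exact: ltW|apply: finite_pvarD|].
- exact: ltW.
- by apply: finite_pvar_cst; rewrite gt_eqF.
- exact: MT.
- by apply: finite_pvar_bounded_variation => //; [lra|exact: bA].
Qed.

End semimartingale_pvariation.

(** * Jumps of càdlàg paths *)

Lemma near_all {U : eqType} {T : Type} (G : set_system T) {FG : Filter G}
    (l : seq U) (Q : T -> U -> Prop) :
  (forall u, u \in l -> \forall x \near G, Q x u) ->
  \forall x \near G, forall u, u \in l -> Q x u.
Proof.
elim: l => [|a l IH] H; first by apply: nearW.
have Ha := H a (mem_head _ _).
have Hl : \forall x \near G, forall u, u \in l -> Q x u.
  by apply: IH => u ul; apply: H; rewrite inE ul orbT.
apply: filterS2 Ha Hl => x Qa Ql u; rewrite inE => /predU1P[->//|].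
exact: Ql.
Qed.

Section jumps_of_paths.
Context {R : realType} {d : nat}.
Variable x : R -> 'rV[R]_d.
Hypothesis cx : cadlag x.

Lemma cvg_left_lim t : 0 < t -> x s @[s --> t^'-] --> left_lim x t.
Proof. by move=> t0; have [_ /(_ t t0)[l xl]] := cx; exact: cvgP xl. Qed.

Lemma cvg_increment_jump t : 0 < t ->
  x t - x (t - h) @[h --> 0^'+] --> jump x t.
Proof.
move=> t0; apply: cvgB; first exact: cvg_cst.
suff cvl : (fun h => t - h) @ 0^'+ --> t^'-.
  exact: cvg_comp cvl (cvg_left_lim t0).
have ch : (fun h : R => t - h) @ (0 : R) --> t.
  by rewrite -[X in _ --> X]subr0; apply: cvgB; [exact: cvg_cst|exact: cvg_id].
move=> A tA.
have H : \forall h \near (0 : R), t - h < t -> A (t - h) := ch _ tA.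
suff : \forall h \near 0^'+, A (t - h) by [].
by rewrite near_withinE; apply: filterS H => h H h0; apply: H; rewrite gtrBl.
Qed.

(** Pairing each jump time with a slightly earlier time yields disjoint
    intervals. *)
Lemma sum_jumps_bounded (p T : R) : 0 < p -> finite_pvar p T x ->
  exists C, forall A : seq R, uniq A -> all (fun s => 0 < s <= T) A ->
    \sum_(s <- A) `|jump x s| `^ p <= C.
Proof.
move=> p0 [C xC]; exists C => A uA AT.
rewrite -(perm_big _ (permEl (perm_sort <=%O A))) /=.
have {}AT : all (fun s => 0 < s <= T) (sort <=%O A) by rewrite all_sort.
have {uA} : pairwise <%O (sort <=%O A).
  by rewrite -sorted_pairwise; [rewrite sort_lt_sorted|exact: lt_trans].
move: (sort _ A) AT => {}A AT pA.
have dA : \forall h \near 0^'+, disjoint_itvs T [seq (s - h, s) | s <- A].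
  elim: A pA AT => [|a A IH] /=; first by move=> _ _; apply: nearW.
  move=> /andP[aA pA] /andP[/andP[a0 aT] AT].
  have {}IH := IH pA AT.
  have Ha : \forall h \near 0^'+, all (fun s => a <= s - h) A.
    near=> h; apply/allP; near: h; apply: near_all => s sA; near=> h.
    rewrite lerBrDl -lerBrDr.
    by near: h; apply: nbhs_right_le; rewrite subr_gt0 (allP aA).
  near=> h; rewrite disjoint_itvs_cons /= aT all_map subr_ge0 /=.
  apply/and4P; split.
  - by near: h; exact: nbhs_right_le.
  - by rewrite gerBl ltW.
  - by near: h; exact: Ha.
  - by near: h; exact: IH.
have cvA : \sum_(s <- A) `|x s - x (s - h)| `^ p @[h --> 0^'+] -->
    \sum_(s <- A) `|jump x s| `^ p.
  elim: A AT {pA dA} => [|a A IH] /=.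
    move=> _; under eq_fun do rewrite big_nil.
    by rewrite big_nil; exact: cvg_cst.
  move=> /andP[/andP[a0 _] AT].
  under eq_fun do rewrite big_cons; rewrite big_cons.
  apply: cvgD (IH AT); apply: cvg_powR => //.
  by apply: cvg_norm; exact: cvg_increment_jump.
apply: (cvgr_to_le cvA).
by apply: filterS dA => h /xC; rewrite big_map.
Unshelve. all: by end_near. Qed.

(** Each jump larger than [e] takes at least [e `^ p] from the bound on the sum
    of the [p]-th powers of the jumps. *)
Lemma big_jumps_finite (p T e : R) : 0 < p -> finite_pvar p T x -> 0 < e ->
  exists2 L : seq R, uniq L &
    forall s, (s \in L) = (0 < s <= T) && (e < `|jump x s|).
Proof.
move=> p0 xp e0; have [C xC] := sum_jumps_bounded p0 xp.
suff /finite_seqP[L LE] : finite_set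
    [set s | (0 < s <= T) && (e < `|jump x s|)].
  exists (undup L); first exact: undup_uniq.
  move=> s; rewrite mem_undup.
  by have := congr1 (fun B : set R => B s) LE => /= /esym E; apply/idP/idP;
    [rewrite E|rewrite -E].
apply: contrapT => infB.
pose N := (Num.truncn (C / e `^ p)).+1.
have [D DB An] := infinite_set_fset N infB.
pose A : seq R := finmap.enum_fset D.
have ep : 0 < e `^ p by exact: powR_gt0.
have AT : all (fun s => (0 < s <= T) && (e < `|jump x s|)) A.
  by apply/allP => s sA; exact: DB.
have := xC A (finmap.fset_uniq D) (sub_all (fun s => fun H => (andP H).1) AT).
rewrite leNgt => /negP; apply.
apply: (@lt_le_trans _ _ (\sum_(s <- A) e `^ p)); last first.
  rewrite big_seq [leRHS]big_seq; apply: ler_sum => s sA.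
  have /andP[_ es] := allP AT s sA.
  by apply: ge0_ler_powR; rewrite ?nnegrE ?(ltW p0) ?(ltW e0) ?(ltW es).
rewrite big_const_seq count_predT iter_addr addr0 -mulr_natl -ltr_pdivrMr//.
by apply: lt_le_trans (truncnS_gt _) _; rewrite ler_nat.
Qed.

(** Near each time the path is close to its value on the right and to its left
    limit on the left, so an interval without jump larger than [e] has an
    increment of at most [3 * e]; compactness makes the scale uniform. *)
Lemma cadlag_modulus (T e : R) : 0 < e ->
  \forall h \near 0^'+, forall s t, 0 <= s <= T -> s < t < s + h ->
    (forall u, s < u <= t -> `|jump x u| <= e) -> `|x t - x s| <= 3 * e.
Proof.
move=> e0; have [rx _] := cx.
have /compact_near_coveringP cov := @segment_compact R 0 T.
pose Q h s := 0 <= s -> forall t, s < t < s + h ->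
  (forall u, s < u <= t -> `|jump x u| <= e) -> `|x t - x s| <= 3 * e.
suff H : forall u, `[0, T]%classic u -> \forall s \near u & h \near 0^'+, Q h s.
  apply: filterS (cov R 0^'+ Q _ H) => h HQ s t /andP[s0 sT].
  by apply: HQ => //=; rewrite in_itv/= s0.
move=> u; rewrite /= in_itv/= => /andP[u0 _].
have : \forall s \near u, u < s -> `|x u - x s| <= e.
  by have /cvgrPdist_le/(_ e e0) := rx u u0; rewrite near_withinE.
move=> /nbhs_ballP[r /= r0 Hr].
have : \forall s \near u, 0 < u -> s < u -> `|left_lim x u - x s| <= e.
  move: u0; rewrite le_eqVlt => /predU1P[u0|u0].
    by near=> s; rewrite -u0 ltxx.
  have /cvgrPdist_le/(_ e e0) := cvg_left_lim u0.
  by rewrite near_withinE => H; apply: filterS H => s H _.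
move=> /nbhs_ballP[r' /= r'0 Hr'].
pose m := Num.min r r' / 2; have m0 : 0 < m by rewrite divr_gt0// lt_min r0.
have mr : 2 * m <= r by rewrite /m mulrC divfK// ge_min lexx.
have mr' : 2 * m <= r' by rewrite /m mulrC divfK// ge_min lexx orbT.
have right v : u <= v -> v < u + 2 * m -> `|x u - x v| <= e.
  rewrite le_eqVlt => /predU1P[<-|uv] vm; first by rewrite subrr normr0 ltW.
  by apply: Hr => //; rewrite /ball/= ltr_distl; lra.
have left v : 0 <= v -> v < u -> u - 2 * m < v -> `|left_lim x u - x v| <= e.
  move=> v0 vu um; apply: Hr' => //; last exact: le_lt_trans vu.
  by rewrite /ball/= ltr_distl; lra.
exists (ball u m, [set h | 0 < h < m]).
  split => /=; first exact: nbhsx_ballx.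
  by near=> h; apply/andP; split => //; near: h; exact: nbhs_right_lt.
move=> [s h] [/= us /andP[h0 hm]] s0 t /andP[st th] J.
move: us; rewrite /ball/= ltr_distl => /andP[us su].
have [us'|su'] := leP u s.
  have H1 := right s us' _; have H2 := right t _ _.
  have := ler_distD (x u) (x t) (x s); rewrite [`|x t - x u|]distrC.
  have := H1 ltac:(lra); have := H2 ltac:(lra) ltac:(lra); lra.
have Ls := left s s0 su' ltac:(lra).
have [ut|tu] := leP u t; last first.
  have Lt := left t ltac:(lra) tu ltac:(lra).
  have := ler_distD (left_lim x u) (x t) (x s).
  by rewrite [`|x t - left_lim _ _|]distrC; lra.
have Rt := right t ut ltac:(lra).
have Ju := J u; rewrite su' ut in Ju; have {}Ju := Ju isT.
have := ler_distD (x u) (x t) (x s); rewrite [`|x t - x u|]distrC.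
have := ler_distD (left_lim x u) (x u) (x s); rewrite -/(jump x u); lra.
Unshelve. all: by end_near. Qed.

End jumps_of_paths.

(** * Time changes through prescribed points *)

Section ramps.
Context {R : realType}.

Definition ramp (a b t : R) : R := Num.min 1 (Num.max 0 ((t - a) / (b - a))).

Lemma ramp_homo a b t u : a < b -> t <= u -> ramp a b t <= ramp a b u.
Proof.
move=> ab tu; have qle : (t - a) / (b - a) <= (u - a) / (b - a).
  by rewrite ler_pM2r ?invr_gt0 ?subr_gt0// lerB.
rewrite /ramp le_min ge_min lexx/= ge_min ge_max !le_max lexx qle.
by rewrite !orbT.
Qed.

Lemma ramp_le1 a b t : ramp a b t <= 1.
Proof. by rewrite ge_min lexx. Qed.

Lemma ramp_ge0 a b t : 0 <= ramp a b t.
Proof. by rewrite le_min ler01 le_max lexx. Qed.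

Lemma ramp_eq0 a b t : a < b -> t <= a -> ramp a b t = 0.
Proof.
move=> ab ta; rewrite /ramp max_l ?min_r//.
by rewrite pmulr_lle0 ?invr_gt0 ?subr_gt0// subr_le0.
Qed.

Lemma ramp_eq1 a b t : a < b -> b <= t -> ramp a b t = 1.
Proof.
move=> ab bt; rewrite /ramp min_l// le_max ler_pdivlMr ?subr_gt0// mul1r.
by rewrite lerB ?orbT.
Qed.

Lemma ramp_inside a b t : a <= t -> t < b -> ramp a b t = (t - a) / (b - a).
Proof.
move=> a_t tb; have ab := le_lt_trans a_t tb.
rewrite /ramp max_r ?min_r// ?ler_pdivrMr ?subr_gt0// ?mul1r ?lerB ?(ltW tb)//.
by rewrite divr_ge0// subr_ge0// ltW.
Qed.

Lemma ramp_lt a b t u : a <= t -> t < b -> t < u -> ramp a b t < ramp a b u.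
Proof.
move=> a_t tb tu; have ab := le_lt_trans a_t tb.
rewrite (ramp_inside a_t tb); have [ub|bu] := ltP u b.
  rewrite ramp_inside// ?(le_trans a_t (ltW tu))//.
  by rewrite ltr_pM2r ?invr_gt0 ?subr_gt0// ltrD2r.
by rewrite ramp_eq1// ltr_pdivrMr ?subr_gt0// mul1r ltrD2r.
Qed.

Lemma ramp_continuous a b : continuous (ramp a b).
Proof.
move=> t; have cq : {for t, continuous (fun u : R => (u - a) / (b - a))}.
  by apply: cvgMr_tmp; apply: cvgB; [exact: cvg_id|exact: cvg_cst].
have c0 : {for t, continuous (fun _ : R => 0 : R)} by exact: cvg_cst.
have c1 : {for t, continuous (fun _ : R => 1 : R)} by exact: cvg_cst.
exact: (continuous_min c1 (continuous_max c0 cq)).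
Qed.

End ramps.

(** Given one point [s i.+1] in each cell [(i D, (i + 1) D]], the piecewise
    linear time change sends [s i] to [i D]. Its values are sums of ramps, so
    that continuity and monotonicity hold term by term. *)
Section cell_time_change.
Context {R : realType}.
Variables (D : R) (s : nat -> R).
Hypotheses (D0 : 0 < D) (s0 : s 0%N = 0).
Hypothesis cell_s : forall i : nat, i%:R * D < s i.+1 <= i.+1%:R * D.

(** The ramps of index beyond this range vanish up to time [t]. *)
Definition cell_change (t : R) : R :=
  D * \sum_(j < (Num.truncn (t / D)).+2) ramp (s j) (s j.+1) t.

Let s_le i : s i <= i%:R * D.
Proof. by case: i => [|i]; [rewrite s0 mul0r|case/andP: (cell_s i)]. Qed.

Lemma cell_lt i : s i < s i.+1.
Proof. by have /andP[+ _] := cell_s i; apply: le_lt_trans. Qed.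

Lemma cell_le i j : (i <= j)%N -> s i <= s j.
Proof.
apply: (homo_leq (r := fun a b : R => a <= b)) => // [b a c|k].
  exact: le_trans.
exact/ltW/cell_lt.
Qed.

Lemma cell_inj : injective s.
Proof.
move=> i j sij; apply/eqP; rewrite eqn_leq; apply/andP; split;
  rewrite leqNgt; apply/negP => /cell_le.
  by rewrite sij leNgt cell_lt.
by rewrite -sij leNgt cell_lt.
Qed.

Let cell_change_ext t m : ((Num.truncn (t / D)).+2 <= m)%N ->
  cell_change t = D * \sum_(j < m) ramp (s j) (s j.+1) t.
Proof.
move=> tm; rewrite /cell_change; congr (_ * _).
rewrite -(subnKC tm) [RHS]big_split_ord/= [X in _ + X]big1 ?addr0// => j _.
apply: ramp_eq0; first exact: cell_lt.
have /andP[+ _] := cell_s ((Num.truncn (t / D)).+1 + j); rewrite addSn.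
move=> /ltW; apply: le_trans; rewrite -ler_pdivrMr//.
by apply: le_trans (ltW (truncnS_gt _)) _; rewrite ler_nat ?addSn ltnS leq_addr.
Qed.

Lemma cell_change_ge t k : s k <= t -> k%:R * D <= cell_change t.
Proof.
move=> skt; pose m := maxn (Num.truncn (t / D)).+2 k.
rewrite (@cell_change_ext t m) ?leq_maxl// mulrC ler_pM2l//.
rewrite -(subnKC (leq_maxr _ k : (k <= m)%N)) big_split_ord/=.
rewrite -[leLHS]addr0 lerD ?sumr_ge0// => [|j _]; last exact: ramp_ge0.
rewrite -[X in X%:R]card_ord -sumr_const le_eqVlt; apply/orP; left; apply/eqP.
apply: eq_bigr => j _; rewrite ramp_eq1//; first exact: cell_lt.
by apply: le_trans skt; exact: cell_le.
Qed.

Lemma cell_change_lt t k : t < s k.+1 -> cell_change t < k.+1%:R * D.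
Proof.
move=> tsk; pose m := maxn (Num.truncn (t / D)).+2 k.+1.
rewrite (@cell_change_ext t m) ?leq_maxl// mulrC ltr_pM2r//.
rewrite -(subnKC (leq_maxr _ k.+1 : (k.+1 <= m)%N)) big_split_ord/=.
rewrite [X in _ + X]big1 ?addr0 => [|j _]; last first.
  apply: ramp_eq0; first exact: cell_lt.
  by apply: le_trans (ltW tsk) _; exact: cell_le (leq_addr _ _).
rewrite big_ord_recr/= -natr1; apply: ler_ltD.
  rewrite -[X in _ <= X%:R]card_ord -sumr_const.
  by apply: ler_sum => j _; exact: ramp_le1.
have [skt|tsk'] := leP (s k) t; last by rewrite ramp_eq0 ?ltr01 ?cell_lt ?ltW.
rewrite ramp_inside// ltr_pdivrMr ?subr_gt0 ?cell_lt// mul1r.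
by rewrite ltrD2r.
Qed.

Lemma cell_changeP t k : (k.+1%:R * D <= cell_change t) = (s k.+1 <= t).
Proof.
apply/idP/idP; last exact: cell_change_ge.
by apply: contraTT; rewrite -!ltNge; exact: cell_change_lt.
Qed.

Lemma cell_change0 : cell_change 0 = 0.
Proof.
rewrite /cell_change big1 ?mulr0// => j _.
by apply: ramp_eq0; [exact: cell_lt|by have := cell_le (leq0n j); rewrite s0].
Qed.

Lemma cell_change_dist t : 0 <= t -> `|cell_change t - t| <= 2 * D.
Proof.
move=> t0; have := truncn_itv (divr_ge0 t0 (ltW D0)).
set n := Num.truncn _; rewrite ler_pdivlMr// ltr_pdivrMr// => /andP[nt tn].
have lo := cell_change_ge (le_trans (s_le n) nt).
have /andP[sn _] := cell_s n.+1.
have hi := cell_change_lt (lt_trans tn sn).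
move: nt tn lo hi; rewrite -!natr1 ler_norml !mulrDl !mul1r => nt tn lo hi.
by apply/andP; split; lra.
Qed.

Lemma cell_change_homo t u : 0 <= t -> t < u -> cell_change t < cell_change u.
Proof.
move=> t0 tu; have := truncn_itv (divr_ge0 t0 (ltW D0)).
set n := Num.truncn _; rewrite ler_pdivlMr// ltr_pdivrMr// => /andP[nt tn].
have [k [kt tk kn]] : exists k, [/\ s k <= t, t < s k.+1 & (k <= n.+1)%N].
  have [st|ts] := leP (s n.+1) t; last first.
    by exists n; split => //; exact: le_trans (s_le n) nt.
  by exists n.+1; split => //; have /andP[+ _] := cell_s n.+1; exact: lt_trans.
pose m := maxn n.+2 (Num.truncn (u / D)).+2.
rewrite (@cell_change_ext t m) ?leq_maxl// (@cell_change_ext u m) ?leq_maxr//.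
have km : (k < m)%N by rewrite (leq_ltn_trans kn)// leq_max ltnS leqnn.
rewrite ltr_pM2l// (bigD1 (Ordinal km))//= [ltRHS](bigD1 (Ordinal km))//=.
apply: ltr_leD; first exact: ramp_lt.
by apply: ler_sum => j _; apply: ramp_homo; [exact: cell_lt|exact: ltW].
Qed.

Lemma cell_change_continuous : continuous cell_change.
Proof.
move=> t; pose m := (Num.truncn (t / D)).+2.
have cm : D * \sum_(j < m) ramp (s j) (s j.+1) u @[u --> t] -->
    D * \sum_(j < m) ramp (s j) (s j.+1) t.
  apply: cvgMl_tmp; elim: m => [|m IH].
    by under eq_fun do rewrite big_ord0; rewrite big_ord0; exact: cvg_cst.
  under eq_fun do rewrite big_ord_recr/=; rewrite big_ord_recr/=.
  by apply: cvgD => //; exact: ramp_continuous.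
rewrite /continuous_at (@cell_change_ext t m)//.
apply: cvg_trans cm; apply: near_eq_cvg.
near=> u; rewrite (@cell_change_ext u m)// /m !ltnS.
rewrite truncn_le_nat ltr_pdivrMr//.
near: u; apply: lt_nbhsl.
by rewrite -ltr_pdivrMr ?truncnS_gt.
Unshelve. all: by end_near. Qed.

Lemma time_change_cell_change : time_change cell_change.
Proof.
split.
- exact: cell_change0.
- by apply: continuous_subspaceT => t; exact: cell_change_continuous.
- move=> t u; rewrite !in_itv/= !andbT => t0 _; exact: cell_change_homo.
- apply/cvgryPge => A; near=> t.
  have t0 : 0 <= t by near: t; apply: nbhs_pinfty_ge; exact: num_real.
  have := cell_change_dist t0; rewrite ler_norml => /andP[+ _].
  have : A + 2 * D <= t by near: t; apply: nbhs_pinfty_ge; exact: num_real.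
  by lra.
Unshelve. all: by end_near. Qed.

End cell_time_change.

(** * Locally uniform limits of càdlàg functions *)

Section cadlag_limits.
Context {R : realType} {q : nat}.
Implicit Types y z : R -> 'rV[R]_q.

Lemma cadlag_uniform_approx y :
  (forall N e : R, 0 < e ->
    exists2 z : R -> 'rV[R]_q, cadlag z &
      forall t : R, 0 <= t <= N -> `|y t - z t| <= e) ->
  cadlag y.
Proof.
move=> yz; split=> t t0.
  apply/cvgrPdist_le => e e0; have e30 : 0 < e / 3 by lra.
  have [z [rz _] yze] := yz (t + 1) _ e30.
  have /cvgrPdist_le/(_ _ e30) zt := rz t t0; near=> s.
  have ts : t < s by [].
  have st : s < t + 1 by near: s; apply: nbhs_right_lt; rewrite ltrDl.
  have yzt : `|y t - z t| <= e / 3 by apply: yze; rewrite t0 lerDl ler01.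
  have yzs : `|y s - z s| <= e / 3.
    by apply: yze; rewrite (le_trans t0 (ltW ts)) ltW.
  have zts : `|z t - z s| <= e / 3 by near: s.
  have := ler_distD (z t) (y t) (y s); have := ler_distD (z s) (z t) (y s).
  by rewrite [`|z s - y s|]distrC; lra.
suff : cvg (y s @[s --> t^'-]) by move=> /cvg_ex.
apply: cauchy_cvg; apply: cauchy_exP => e e0; have e20 : 0 < e / 2 by lra.
have e40 : 0 < e / 4 by lra.
have [z [_ lz] yze] := yz t _ e40.
have [l zl] := lz t t0; exists l.
have /cvgrPdist_le/(_ _ e40) zt := zl.
suff : \forall s \near t^'-, ball l e (y s) by [].
near=> s; rewrite -ball_normE /ball_/=.
have st : s < t by [].
have s0 : 0 < s by near: s; exact: nbhs_left_gt.
have yzs : `|y s - z s| <= e / 4 by apply: yze; rewrite !ltW.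
have zts : `|l - z s| <= e / 4 by near: s.
have := ler_distD (z s) l (y s).
by rewrite [`|z s - y s|]distrC; lra.
Unshelve. all: by end_near. Qed.

Lemma cadlag_step (I : Type) (A : seq I) (tau : I -> R) (c : I -> 'rV[R]_q) :
  cadlag (fun t => \sum_(i <- A | tau i <= t) c i).
Proof.
elim: A => [|a A IH].
  under eq_fun do rewrite big_nil; exact: cadlag_cst.
under eq_fun do rewrite big_mkcond/= big_cons -big_mkcond/=.
apply: cadlagD => // {IH}; split=> t t0.
  apply: cvg_near_cst; have [at_|ta] := leP (tau a) t.
    near=> s; suff -> : tau a <= s by [].
    by apply: (le_trans at_); apply: ltW.
  near=> s; rewrite leNgt; suff -> : s < tau a by [].
  by near: s; exact: nbhs_right_lt.
have [at_|ta] := ltP (tau a) t; [exists (c a)|exists 0]; apply: cvg_near_cst.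
  near=> s; suff -> : tau a <= s by [].
  by apply: ltW; near: s; exact: nbhs_left_gt.
near=> s; rewrite leNgt; suff -> : s < tau a by [].
by apply: lt_le_trans ta.
Unshelve. all: by end_near. Qed.

End cadlag_limits.

Lemma uniform_cvgP {R : realType} {V : normedModType R} (A : set R)
    (u : nat -> R -> V) (v : R -> V) :
  (forall e, 0 < e ->
    \forall n \near \oo, forall t, A t -> `|v t - u n t| <= e) ->
  {uniform A, u @ \oo --> v}.
Proof.
move=> H P /uniform_nbhs[E [entE EP]].
move: entE; rewrite -entourage_ballE => -[e /= e0 eE].
have e20 : 0 < e / 2 by lra.
apply: filterS (H _ e20) => n Hn; apply: EP => t At; apply: eE => /=.
by rewrite -ball_normE /ball_/=; apply: le_lt_trans (Hn t At) _; lra.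
Qed.

(** * Sums over uncountable sets of times *)

Section signed_esum.
Context {R : realType}.
Variables (h : R -> R) (t eta : R) (L : seq R).
Hypotheses (uL : uniq L) (Lt : all (fun s => 0 < s <= t) L).
Hypothesis small : forall A : seq R, uniq A ->
  all (fun s => (0 < s <= t) && (s \notin L)) A ->
  \sum_(s <- A) `|h s| <= eta.

Let rest : set R := `]0, t] `&` ~` [set` L].

Let rest_le : (\esum_(s in rest) `|h s|%:E <= eta%:E)%E.
Proof.
apply: ge_ereal_sup => _ [A [fA AB] <-].
have [B [uB AE]] : exists B : seq R, uniq B /\ A = [set` B].
  have /finite_seqP[B ->] := fA; exists (undup B).
  rewrite undup_uniq; split => //.
  by apply/seteqP; split => s /=; rewrite mem_undup.
rewrite AE -fsbig_seq// sumEFin lee_fin; apply: small => //.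
apply/allP => s sB; have : rest s by apply: AB; rewrite AE.
by rewrite /rest/= in_itv/= => -[-> /negP].
Qed.

Let esum_split (g : R -> R) : (forall s, 0 <= g s) ->
  (\esum_(s in `]0%R, t]) (g s)%:E =
   (\sum_(s <- L) g s)%R%:E + \esum_(s in rest) (g s)%:E)%E.
Proof.
move=> g0; rewrite [LHS](esumID [set` L]); last by move=> s _; rewrite lee_fin.
congr (_ + _)%E; rewrite (_ : _ `&` _ = [set` L]).
  have gL s : s \in [set` L] -> (0 <= (g s)%:E)%E by rewrite lee_fin.
  by rewrite (esum_fset (finite_seq L) gL) -fsbig_seq// sumEFin.
apply/seteqP; split => s /=; first by case.
by move=> sL; split => //; rewrite in_itv/=; exact: (allP Lt).
Qed.

Lemma summable_of_finite_part : summable `]0, t] (fun s => (h s)%:E).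
Proof.
rewrite /summable; under eq_esum do rewrite abse_EFin.
rewrite (@esum_split (fun s => `|h s|))//.
by apply: lte_add_pinfty; [exact: ltry|exact: le_lt_trans rest_le (ltry _)].
Qed.

(** The sum over [`]0, t]] is the finite sum over [L] plus the difference of the
    positive and negative parts of the rest, which add up to the sum of the
    absolute values. *)
Lemma signed_esum_dist :
  `|fine (\esum_(s in `]0, t]) ((EFin \o h)^\+ s)%E)
    - fine (\esum_(s in `]0, t]) ((EFin \o h)^\- s)%E)
    - \sum_(s <- L) h s| <= eta.
Proof.
pose hp s := Num.max (h s) 0; pose hm s := Num.max (- h s) 0.
have hp0 s : 0 <= hp s by rewrite le_max lexx orbT.
have hm0 s : 0 <= hm s by rewrite le_max lexx orbT.
have hpm s : `|h s| = hp s + hm s.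
  rewrite /hp /hm; have [h0|h0] := leP 0 (h s).
    by rewrite max_r ?addr0 ?ger0_norm//; lra.
  by rewrite max_l ?add0r ?ltr0_norm//; lra.
have hE s : h s = hp s - hm s.
  rewrite /hp /hm; have [h0|h0] := leP 0 (h s).
    by rewrite max_r ?subr0//; lra.
  by rewrite max_l ?sub0r ?opprK//; lra.
have -> : (\esum_(s in `]0%R, t]) ((EFin \o h)^\+ s) =
    \esum_(s in `]0%R, t]) (hp s)%:E)%E.
  by apply: eq_esum => s _; rewrite funeposE /= -EFin_max.
have -> : (\esum_(s in `]0%R, t]) ((EFin \o h)^\- s) =
    \esum_(s in `]0%R, t]) (hm s)%:E)%E.
  by apply: eq_esum => s _; rewrite funenegE /= -EFin_max.
rewrite !esum_split//.
set ep := esum rest _; set em := esum rest _.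
have epm : (ep + em <= eta%:E)%E.
  rewrite /ep /em -esumD => [||s _]; last by rewrite lee_fin.
  - by apply: le_trans rest_le; apply: le_esum => s _; rewrite -EFinD hpm.
  - by move=> s _; rewrite lee_fin.
have ep0 : (0 <= ep)%E by apply: esum_ge0 => s _; rewrite lee_fin.
have em0 : (0 <= em)%E by apply: esum_ge0 => s _; rewrite lee_fin.
have [fp fm] : ep \is a fin_num /\ em \is a fin_num.
  rewrite !ge0_fin_numE//; split; apply: le_lt_trans (ltry eta);
    apply: le_trans epm; [exact: leeDl|exact: leeDr].
rewrite !fineD//= -{}(fineK fp) -{}(fineK fm) in epm ep0 em0 *.
under [X in _ - X]eq_bigr do rewrite hE.
rewrite sumrB ler_norml; move: epm ep0 em0; rewrite -EFinD !lee_fin /=.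
by move=> *; apply/andP; split; lra.
Qed.

End signed_esum.

(** * The pathwise limit theorem *)

Section cells.
Context {R : realType}.

Lemma cell_exists (D s : R) : 0 < D -> 0 < s ->
  exists i : nat, i%:R * D < s <= i.+1%:R * D.
Proof.
move=> D0 s0; have := truncn_itv (divr_ge0 (ltW s0) (ltW D0)).
set k := Num.truncn _; rewrite ler_pdivlMr// ltr_pdivrMr// => /andP[].
rewrite le_eqVlt => /predU1P[ks _|ks sk]; last by exists k; rewrite ks ltW.
case: k ks => [|k] ks; first by rewrite -ks mul0r ltxx in s0.
by exists k; rewrite -ks lexx andbT ltr_pM2r// ltr_nat.
Qed.

Lemma cell_unique (D s : R) (i j : nat) : 0 < D ->
  i%:R * D < s <= i.+1%:R * D -> j%:R * D < s <= j.+1%:R * D -> i = j.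
Proof.
move=> D0; wlog ij : i j / (i <= j)%N => [H|/andP[_ si] /andP[js _]].
  have [ij|/ltnW ji] := leqP i j; first exact: H.
  by move=> ? ?; apply/esym/H.
apply/eqP; rewrite eqn_leq ij leqNgt; apply/negP => ij'.
have := lt_le_trans js si; rewrite ltr_pM2r// ltr_nat.
by rewrite ltnS leqNgt ij'.
Qed.

Lemma cvg_at_left_seq (u : nat -> R) (a : R) : (forall n, u n < a) ->
  u @ \oo --> a -> u @ \oo --> a^'-.
Proof.
move=> ua uca A aA.
have H : \forall n \near \oo, u n < a -> A (u n) := uca _ aA.
suff : \forall n \near \oo, A (u n) by [].
by apply: filterS H => n /(_ (ua n)).
Qed.

Lemma seq_argmax (I : eqType) (F : I -> R) (l : seq I) : l != [::] ->
  exists2 m, m \in l & forall i, i \in l -> F i <= F m.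
Proof.
elim: l => // a [|b l] IH _.
  by exists a; rewrite ?mem_head// => i; rewrite inE => /eqP ->.
have [//|m ml Hm] := IH _; have [Fam|Fma] := leP (F a) (F m).
  exists m; first by rewrite inE ml orbT.
  by move=> i; rewrite inE => /predU1P[->//|/Hm].
exists a; first exact: mem_head.
move=> i; rewrite inE => /predU1P[->//|/Hm Fim].
exact: le_trans Fim (ltW Fma).
Qed.

End cells.

Lemma coord_norm_le {R : realType} {q : nat} (u : 'rV[R]_q) (j : 'I_q) :
  `|u ord0 j| <= `|u|.
Proof.
rewrite [leRHS]mx_normrE.
exact: (le_bigmax _ (fun ij : 'I_1 * 'I_q => `|u ij.1 ij.2|) (ord0, j)).
Qed.

Section pathwise.
Context {R : realType} {Omega : Type} {d q : nat}.
Variable f : Omega -> R -> 'rV[R]_d -> 'rV[R]_d -> 'rV[R]_q.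
Variables (X : R -> Omega -> 'rV[R]_d) (w : Omega) (p p' : R).
Let x : R -> 'rV[R]_d := X^~ w.

Hypotheses (p'0 : 0 < p') (p'p : p' < p).
Hypothesis cx : cadlag x.
Hypothesis xp' : forall T : nat, finite_pvar p' T%:R x.
Hypothesis f_left : forall t z y, 0 < t -> exists l, is_left_value f w t z y l.
Hypothesis f_small : forall T K : R, exists eps G : R, [/\ 0 < eps, 0 <= G &
  forall s z y, 0 <= s <= T -> `|z| <= K -> `|y| <= eps ->
    `|f w s z y| <= G * `|y| `^ p].

Let Dt := Dterm f X w.

(** The growth bound passes to the left value along times increasing to [s], the
    last argument of [f] being kept equal to the jump. *)
Lemma Dterm_left_value s : 0 < s ->
  is_left_value f w s (left_lim x s) (jump x s) (Dt s).
Proof. by move=> s0; apply: getPex; exact: f_left. Qed.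

Lemma Dterm_le (T K G eps : R) :
  (forall s z y, 0 <= s <= T -> `|z| <= K -> `|y| <= eps ->
    `|f w s z y| <= G * `|y| `^ p) ->
  (forall s, 0 <= s <= T -> `|x s| <= K) ->
  forall s, 0 < s <= T -> `|jump x s| <= eps ->
    `|Dt s| <= G * `|jump x s| `^ p.
Proof.
move=> fG xK s /andP[s0 sT] Je.
pose u n : R := s - s / n.+2%:R.
have us n : u n < s by rewrite gtrBl divr_gt0.
have u0 n : 0 <= u n.
  by rewrite subr_ge0 ler_pdivrMr// ler_peMr ?(ltW s0)// ler1n.
have ucv : u @ \oo --> s.
  rewrite -[X in _ --> X]subr0; apply: cvgB; first exact: cvg_cst.
  rewrite -[X in _ --> X](mulr0 s); apply: cvgMl_tmp.
  by have := @cvg_harmonic R; rewrite -(@cvg_shiftS _ (@harmonic R)).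
have ucv' := cvg_at_left_seq us ucv.
have xcv : x (u n) @[n --> \oo] --> left_lim x s.
  exact: cvg_comp ucv' (cvg_left_lim cx s0).
have fcv : f w (u n) (x (u n)) (jump x s) @[n --> \oo] --> Dt s.
  apply: (Dterm_left_value s0 _ ucv xcv) => //; exact: cvg_cst.
apply: (cvgr_to_le (cvg_norm fcv)); apply: nearW => n.
by apply: fG => //; [|apply: xK]; rewrite u0 (le_trans (ltW (us n)) sT).
Qed.

(** Where increments or jumps are at most [b], their [p]-th power is at most
    [b `^ (p - p')] times their [p']-th power, and the sums of the latter are
    bounded. Hence the increments of size at most [3 * eps] and the jumps of size
    at most [eps] contribute at most [e], and finitely many jumps remain. *)
Lemma small_contributions (T : nat) (e : R) : 0 < e -> exists eps L,
  [/\ 0 < eps, uniq L,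
      forall s, (s \in L) = (0 < s <= T%:R) && (eps < `|jump x s|),
      forall A, uniq A -> all (fun s => (0 < s <= T%:R) && (s \notin L)) A ->
        \sum_(s <- A) `|Dt s| <= e &
      forall l, disjoint_itvs T%:R l ->
        all (fun I => `|x I.2 - x I.1| <= 3 * eps) l ->
        \sum_(I <- l) `|f w I.1 (x I.1) (x I.2 - x I.1)| <= e].
Proof.
move=> e0; have [K xK] := cadlag_bounded T%:R cx.
have [eps0 [G [eps00 G0 fG]]] := f_small T%:R K.
have [C1 xC1] := xp' T; have [C2 xC2] := sum_jumps_bounded cx p'0 (xp' T).
pose C := `|C1| + `|C2| + 1.
have [C0 C1C C2C] : [/\ 0 < C, C1 <= C & C2 <= C].
  have := ler_norm C1; have := ler_norm C2.
  have := normr_ge0 C1; have := normr_ge0 C2.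
  by rewrite /C; move=> *; split; lra.
have G1 : 0 < G + 1 by rewrite ltr_wpDl.
have pp0 : 0 < p - p' by rewrite subr_gt0.
(* [b] is chosen for [b `^ (p - p')] not to exceed [a] *)
pose a := e / ((G + 1) * C); have a0 : 0 < a by rewrite divr_gt0// mulr_gt0.
pose b := Num.min eps0 (a `^ (p - p')^-1).
have b0 : 0 < b by rewrite lt_min eps00 powR_gt0.
have bpp : b `^ (p - p') <= a.
  have -> : a = (a `^ (p - p')^-1) `^ (p - p').
    by rewrite -powRrM mulVf ?gt_eqF// powRr1// ltW.
  apply: ge0_ler_powR; rewrite ?nnegrE ?powR_ge0 ?(ltW pp0) ?(ltW b0)//.
  by rewrite /b ge_min lexx orbT.
have small c : 0 <= c <= b -> G * c `^ p <= (G + 1) * a * c `^ p'.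
  move=> /andP[c0 cb].
  have cp : c `^ p <= a * c `^ p'.
    have [->|c1] := eqVneq c 0.
      by rewrite !powR0 ?mulr0 ?gt_eqF// (lt_trans p'0).
    have -> : c `^ p = c `^ (p - p') * c `^ p'.
      by rewrite -powRD ?subrK//; apply/implyP.
    rewrite ler_wpM2r ?powR_ge0//; apply: le_trans bpp.
    by apply: ge0_ler_powR; rewrite ?nnegrE ?(ltW pp0) ?(ltW b0).
  rewrite -mulrA; apply: ler_pM; rewrite ?powR_ge0//.
  by rewrite lerDl.
have total c : c <= C -> (G + 1) * a * c <= e.
  move=> cC; apply: (@le_trans _ _ ((G + 1) * a * C)).
    by rewrite ler_wpM2l// mulr_ge0 ?ltW.
  by rewrite mulrAC mulrC divfK// gt_eqF// mulr_gt0.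
have b30 : 0 < b / 3 by lra.
have beps : b <= eps0 by rewrite ge_min lexx.
have [L uL LE] := big_jumps_finite cx p'0 (xp' T) b30.
exists (b / 3), L; split => //.
- move=> A uA AL.
  have AT : all (fun s => 0 < s <= T%:R) A.
    by apply: sub_all AL => s /andP[].
  apply: (@le_trans _ _ (\sum_(s <- A) (G + 1) * a * `|jump x s| `^ p')).
    rewrite big_seq [leRHS]big_seq; apply: ler_sum => s sA.
    have /andP[sT sL] := allP AL s sA.
    have Jb : `|jump x s| <= b / 3 by rewrite leNgt; move: sL; rewrite LE sT.
    apply: (@le_trans _ _ (G * `|jump x s| `^ p)).
      by apply: (Dterm_le fG xK sT); lra.
    by apply: small; rewrite normr_ge0/=; lra.
  rewrite -mulr_sumr; apply: total; apply: le_trans C2C; exact: xC2.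
- move=> l dl lb.
  apply: (@le_trans _ _ (\sum_(I <- l) (G + 1) * a * `|x I.2 - x I.1| `^ p')).
    rewrite big_seq [leRHS]big_seq; apply: ler_sum => I Il.
    have := allP lb I Il; rewrite mulrC divfK// => Ib.
    have /andP[/allP/(_ I Il)/and3P[I0 I12 I2T] _] := dl.
    have I1T : 0 <= I.1 <= T%:R by rewrite I0 (le_trans I12 I2T).
    apply: (@le_trans _ _ (G * `|x I.2 - x I.1| `^ p)).
      by apply: fG => //; [exact: xK|exact: le_trans Ib beps].
    by apply: small; rewrite normr_ge0.
  rewrite -mulr_sumr; apply: total; apply: le_trans C1C; exact: xC1.
Qed.

Lemma Dsum_approx (T t e : R) (L : seq R) : uniq L ->
  all (fun s => 0 < s <= T) L ->
  (forall A, uniq A -> all (fun s => (0 < s <= T) && (s \notin L)) A ->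
    \sum_(s <- A) `|Dt s| <= e) ->
  0 <= t <= T ->
  Dsummable f X w t /\
  `|Dsum f X w t - \sum_(s <- L | s <= t) Dt s| <= e.
Proof.
move=> uL LT LA /andP[t0 tT].
pose L' := [seq s <- L | s <= t].
have uL' : uniq L' by exact: filter_uniq.
have Lt : all (fun s => 0 < s <= t) L'.
  apply/allP => s; rewrite mem_filter => /andP[-> sL].
  by have /andP[-> _] := allP LT s sL.
have small j A : uniq A -> all (fun s => (0 < s <= t) && (s \notin L')) A ->
    \sum_(s <- A) `|Dt s ord0 j| <= e.
  move=> uA AL; apply: (@le_trans _ _ (\sum_(s <- A) `|Dt s|)).
    by apply: ler_sum => s _; exact: coord_norm_le.
  apply: LA => //; apply: sub_all AL => s /andP[/andP[-> st]].
  by rewrite mem_filter st (le_trans st tT).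
have e0 : 0 <= e by have := LA [::] isT isT; rewrite big_nil.
split; first by move=> j; exact: (summable_of_finite_part uL' Lt (small j)).
rewrite [leLHS]mx_normrE; apply: bigmax_le => // -[i j] _ /=.
rewrite (ord1 i) !mxE summxE -big_filter.
exact: (signed_esum_dist uL' Lt (small j)).
Qed.

Lemma Dterms_summable t : 0 <= t -> Dsummable f X w t.
Proof.
move=> t0; pose T := (Num.truncn t).+1.
have [eps [L [_ uL LE LA _]]] := small_contributions T (@ltr01 R).
have LT : all (fun s => 0 < s <= T%:R) L.
  by apply/allP => s; rewrite LE => /andP[].
have tT : 0 <= t <= T%:R by rewrite t0 ltW// truncnS_gt.
by have [] := Dsum_approx uL LT LA tT.
Qed.

(** The sums over the finitely many larger jumps are step functions, and they
    converge locally uniformly. *)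
Lemma cadlag_Dsum : cadlag (Dsum f X w).
Proof.
apply: cadlag_uniform_approx => N e e0; pose T := (Num.truncn N).+1.
have [eps [L [_ uL LE LA _]]] := small_contributions T e0.
have LT : all (fun s => 0 < s <= T%:R) L.
  by apply/allP => s; rewrite LE => /andP[].
exists (fun t => \sum_(s <- L | s <= t) Dt s); first exact: cadlag_step.
move=> t /andP[t0 tN].
have tT : 0 <= t <= T%:R by rewrite t0 (le_trans tN (ltW (truncnS_gt _))).
by have [] := Dsum_approx uL LT LA tT.
Qed.

Let g (D : R) (i : nat) : 'rV[R]_q :=
  f w (i.-1%:R * D) (x (i.-1%:R * D)) (x (i%:R * D) - x (i.-1%:R * D)).

Lemma Vn_step (D t : R) (m : nat) : 0 < D -> 0 <= t ->
  (Num.truncn (t / D) <= m)%N ->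
  Vn f D X w t = \sum_(1 <= i < m.+1 | i%:R * D <= t) g D i.
Proof.
move=> D0 t0 tm; rewrite /Vn (big_nat_widen _ _ m.+1)//.
apply: eq_bigl => i; rewrite ltnS.
by rewrite truncn_ge_nat ?divr_ge0 ?(ltW D0)// ler_pdivlMr.
Qed.

Lemma cadlag_Vn (D : R) : 0 < D -> cadlag (Vn f D X w).
Proof.
move=> D0; apply: cadlag_uniform_approx => N e e0.
exists (fun t => \sum_(1 <= i < (Num.truncn (N / D)).+1 | i%:R * D <= t) g D i).
  exact: (cadlag_step _ (fun i : nat => i%:R * D)).
move=> t /andP[t0 tN]; rewrite (@Vn_step D t (Num.truncn (N / D)))//.
  by rewrite subrr normr0 ltW.
by rewrite le_truncn// ler_pM2r// invr_gt0.
Qed.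

(** Jumps larger than half of a given one are finitely many, so the largest is
    attained. *)
Lemma jump_argmax (a b : R) : 0 <= a -> a < b -> exists2 s, a < s <= b &
  forall u, a < u <= b -> `|jump x u| <= `|jump x s|.
Proof.
move=> a0 ab.
have [[u [uab Ju]]|noJ] := pselect (exists u, a < u <= b /\ jump x u != 0);
    last first.
  exists b => [|u uab]; first by rewrite ab lexx.
  have [->|Ju] := eqVneq (jump x u) 0; first by rewrite normr0.
  by case: noJ; exists u.
pose T := (Num.truncn b).+1.
have Ju0 : 0 < `|jump x u| by rewrite normr_gt0.
have e0 : 0 < `|jump x u| / 2 by lra.
have [L _ LE] := big_jumps_finite cx p'0 (xp' T) e0.
have mem v : a < v <= b -> `|jump x u| / 2 < `|jump x v| ->
    v \in [seq v <- L | a < v <= b].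
  move=> vab Jv; rewrite mem_filter vab LE Jv andbT/=.
  have /andP[av vb] := vab; rewrite (le_lt_trans a0 av)/=.
  exact: le_trans vb (ltW (truncnS_gt _)).
have uL := mem u uab ltac:(lra).
have [|s] := @seq_argmax _ _ (fun v => `|jump x v|) [seq v <- L | a < v <= b].
  by apply: contraTneq uL => ->.
rewrite mem_filter => /andP[sab _] Hs; exists s; first exact: sab.
move=> v vab.
have [Jv|Jv] := ltP (`|jump x u| / 2) `|jump x v|; first exact/Hs/mem.
by apply: le_trans Jv _; apply: le_trans (Hs u uL); lra.
Qed.

Section limit.
Variable Delta : nat -> R.
Hypothesis Delta_pos : forall n, 0 < Delta n.
Hypothesis Delta0 : Delta @ \oo --> (0 : R).

Lemma near_Delta_lt (e : R) : 0 < e -> \forall n \near \oo, Delta n < e.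
Proof. by move=> e0; exact: cvgr_lt Delta0 _ e0. Qed.

(** The cell of a jump time shrinks to it from both sides, so the left value
    in the hypothesis is exactly what the term of that cell converges to. *)
Lemma big_jump_cell_cvg (s e : R) : 0 < s -> 0 < e ->
  \forall n \near \oo, forall i : nat,
    i%:R * Delta n < s <= i.+1%:R * Delta n -> `|g (Delta n) i.+1 - Dt s| <= e.
Proof.
move=> s0 e0.
have [k kP] := choice (fun n => cell_exists (Delta_pos n) s0).
pose tn n := (k n)%:R * Delta n; pose un n := (k n).+1%:R * Delta n.
have tns n : tn n < s by have /andP[] := kP n.
have uns n : s <= un n by have /andP[] := kP n.
have utn n : un n = tn n + Delta n by rewrite /un -natr1 mulrDl mul1r.
have tn0 n : 0 <= tn n by rewrite mulr_ge0// ltW.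
have tcv : tn @ \oo --> s.
  apply: (@squeeze_cvgr _ _ _ _ (fun n => s - Delta n) (cst s)).
  - apply: nearW => n; rewrite lerBlDr -utn uns/=; exact: ltW.
  - by rewrite -[X in _ --> X]subr0; apply: cvgB => //; exact: cvg_cst.
  - exact: cvg_cst.
have ucv : un @ \oo --> s.
  rewrite (_ : un = fun n => tn n + Delta n); last exact/funext.
  by rewrite -[X in _ --> X]addr0; exact: cvgD.
have xt : x (tn n) @[n --> \oo] --> left_lim x s.
  exact: cvg_comp (cvg_at_left_seq tns tcv) (cvg_left_lim cx s0).
have xu : x (un n) @[n --> \oo] --> x s.
  apply/cvgrPdist_le => c c0; have [rx _] := cx.
  have /cvgrPdist_le/(_ c c0) := rx s (ltW s0); rewrite near_withinE => H.
  have H' : \forall n \near \oo, s < un n -> `|x s - x (un n)| <= c := ucv _ H.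
  apply: filterS H' => n; have := uns n; rewrite le_eqVlt.
  by move=> /predU1P[<- _|+ ->//]; rewrite subrr normr0 ltW.
have : f w (tn n) (x (tn n)) (x (un n) - x (tn n)) @[n --> \oo] --> Dt s.
  by apply: (Dterm_left_value s0 _ tcv xt) => //; exact: cvgB.
move=> /cvgrPdist_le/(_ e e0); apply: filterS => n ge i iP.
by rewrite (cell_unique (Delta_pos n) iP (kP n)) distrC.
Qed.

(** The mark of index [i.+1] lies in the cell that ends at [i.+1%:R * D], and the
    mark of index 0 is the origin. *)
Definition marks (D : R) (sigma : nat -> R) : Prop :=
  [/\ sigma 0%N = 0, forall i : nat, i%:R * D < sigma i.+1 <= i.+1%:R * D &
      forall (i : nat) u, i%:R * D < u <= i.+1%:R * D ->
        `|jump x u| <= `|jump x (sigma i.+1)|].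

Lemma marks_exist (D : R) : 0 < D -> exists sigma, marks D sigma.
Proof.
move=> D0.
have H (i : nat) : exists s, i%:R * D < s <= i.+1%:R * D /\
    forall u, i%:R * D < u <= i.+1%:R * D -> `|jump x u| <= `|jump x s|.
  have [||s sP Hs] := @jump_argmax (i%:R * D) (i.+1%:R * D).
  - by rewrite mulr_ge0// ltW.
  - by rewrite ltr_pM2r// ltr_nat.
  - by exists s.
have [s sP] := choice H.
exists (fun i => if i is j.+1 then s j else 0).
split; [by []|by move=> i; have [+ _] := sP i|].
by move=> i u; have [_] := sP i; apply.
Qed.

(** With the largest jump of each cell as mark, the approximation jumps, after
    the time change, exactly at the marks: those that are big jumps are matched
    term by term with the jumps of the limit, and the cells of the other marks
    contain no big jump. *)
Lemma Vn_cell_change_near (sigma : nat -> nat -> R) :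
  (forall n, marks (Delta n) (sigma n)) ->
  forall N e : R, 0 < e -> \forall n \near \oo, forall t, 0 <= t <= N ->
    `|Dsum f X w t - Vn f (Delta n) X w (cell_change (Delta n) (sigma n) t)|
      <= e.
Proof.
move=> sigmaP N e e0; have e30 : 0 < e / 3 by lra.
(* the time change moves [t <= N] by at most [2 * D < 2] *)
pose T := (Num.truncn N).+3.
have NT : N + 2 <= T%:R.
  by rewrite /T -!natr1; have := truncnS_gt N; rewrite -natr1; lra.
have [eps [L [eps0 uL LE LA Lf]]] := small_contributions T e30.
have LT : all (fun s => 0 < s <= T%:R) L.
  by apply/allP => s; rewrite LE => /andP[].
pose eta := e / 3 / (size L).+1%:R.
have eta0 : 0 < eta by rewrite divr_gt0.
have [h [h0 modh]] : exists h, 0 < h /\ forall s t, 0 <= s <= T%:R ->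
    s < t < s + h -> (forall u, s < u <= t -> `|jump x u| <= eps) ->
    `|x t - x s| <= 3 * eps.
  near (0 : R)^'+ => h; exists h; split; first by [].
  by near: h; exact: cadlag_modulus.
have near_sep : \forall n \near \oo, forall s, s \in L -> forall s', s' \in L ->
    s != s' -> Delta n < `|s - s'|.
  apply: near_all => s sL; apply: near_all => s' s'L.
  have [->|ss'] := eqVneq s s'; first by apply: nearW.
  have : 0 < `|s - s'| by rewrite normr_gt0 subr_eq0.
  by move=> /near_Delta_lt; apply: filterS.
have near_big : \forall n \near \oo, forall s, s \in L -> forall i : nat,
    i%:R * Delta n < s <= i.+1%:R * Delta n ->
    `|g (Delta n) i.+1 - Dt s| <= eta.
  apply: near_all => s /(allP LT)/andP[s0 _]; exact: big_jump_cell_cvg.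
have near_h := near_Delta_lt h0.
have near_1 := near_Delta_lt (@ltr01 R).
near=> n.
have D1 : Delta n < 1 by near: n.
have Dh : Delta n < h by near: n.
have sep : forall s, s \in L -> forall s', s' \in L ->
    s != s' -> Delta n < `|s - s'| by near: n.
have big : forall s, s \in L -> forall i : nat,
    i%:R * Delta n < s <= i.+1%:R * Delta n ->
    `|g (Delta n) i.+1 - Dt s| <= eta by near: n.
move: (Delta_pos n) (sigmaP n) D1 Dh sep big => /=.
move: (Delta n) (sigma n) => D sig D0 [sig0 sigC sigM] D1 Dh sep big.
move=> t /andP[t0 tN].
set lt := cell_change D sig t.
have lt0 : 0 <= lt.
  have := cell_change_ge D0 sig0 sigC (k := 0) (t := t).
  by rewrite sig0 mul0r; apply.
have ltT : lt <= T%:R.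
  have := cell_change_dist D0 sig0 sigC t0; rewrite -/lt ler_norml.
  by move=> /andP[_]; lra.
pose m := Num.truncn (T%:R / D).
have mT i : (i <= m)%N -> i%:R * D <= T%:R.
  by rewrite truncn_ge_nat ?divr_ge0 ?(ltW D0)// ler_pdivlMr.
rewrite (@Vn_step D lt m)//; last by rewrite le_truncn// ler_pM2r// invr_gt0.
have -> : \sum_(1 <= i < m.+1 | i%:R * D <= lt) g D i =
    \sum_(1 <= i < m.+1 | sig i <= t) g D i.
  rewrite big_nat_cond [RHS]big_nat_cond; apply: eq_bigl => -[|i] //.
  by rewrite /lt cell_changeP.
pose I1 := [seq i <- index_iota 1 m.+1 | (sig i <= t) && (sig i \in L)].
pose I2 := [seq i <- index_iota 1 m.+1 | (sig i <= t) && (sig i \notin L)].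
have -> : \sum_(1 <= i < m.+1 | sig i <= t) g D i =
    \sum_(i <- I1) g D i + \sum_(i <- I2) g D i.
  by rewrite (bigID (fun i => sig i \in L))/= !big_filter.
have I_range i b : i \in [seq i <- index_iota 1 m.+1 | (sig i <= t) && b i] ->
    [/\ exists j, i = j.+1, (i <= m)%N, sig i <= t & b i].
  rewrite mem_filter mem_index_iota => /andP[/andP[it bi] /andP[i0 im]].
  by split => //; exists i.-1; rewrite prednK.
have sigT i : (i.+1 <= m)%N -> 0 < sig i.+1 <= T%:R.
  move=> im; have /andP[lo hi] := sigC i; rewrite (le_trans hi (mT _ im)) andbT.
  by apply: le_lt_trans lo; rewrite mulr_ge0// ltW.
have permI1 : perm_eq [seq sig i | i <- I1] [seq s <- L | s <= t].
  apply: uniq_perm; rewrite ?filter_uniq//.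
    rewrite map_inj_uniq ?filter_uniq ?iota_uniq//.
    exact: (cell_inj sig0 sigC).
  move=> s; rewrite mem_filter; apply/mapP/idP => [[i]|].
    by rewrite mem_filter => /andP[/andP[it iL] _] ->; rewrite it iL.
  move=> /andP[st sL]; have /andP[s0 sT] := allP LT s sL.
  have [i iP] := cell_exists D0 s0; have /andP[iD si] := iP.
  have im : (i.+1 <= m)%N.
    rewrite /m truncn_ge_nat ?divr_ge0 ?(ltW D0)// ler_pdivlMr//.
    by rewrite -natr1 mulrDl mul1r; lra.
  have sigL : sig i.+1 \in L.
    rewrite LE sigT//=; apply: lt_le_trans (sigM i s iP).
    by move: sL; rewrite LE => /andP[].
  have sE : s = sig i.+1.
    suff close : `|s - sig i.+1| <= D.
      by apply/eqP; apply: contraT => /(sep s sL _ sigL); rewrite ltNge close.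
    have /andP[lo hi] := sigC i; move: lo hi iD si.
    rewrite -natr1 mulrDl mul1r ler_norml => lo hi iD si.
    by apply/andP; split; lra.
  by exists i.+1 => //; rewrite mem_filter -sE st sL mem_index_iota.
have tT : 0 <= t <= T%:R by rewrite t0; lra.
have [_ HD] := Dsum_approx uL LT LA tT.
have H1 : `|\sum_(i <- I1) g D i - \sum_(s <- L | s <= t) Dt s| <= e / 3.
  rewrite -[X in _ - X]big_filter -(perm_big _ permI1)/= big_map -sumrB.
  apply: le_trans (ler_norm_sum _ _ _) _.
  apply: (@le_trans _ _ (\sum_(i <- I1) eta)).
    rewrite big_seq [leRHS]big_seq; apply: ler_sum => i.
    by move=> /I_range[[j ->] _ _ jL]; apply: big.
  rewrite big_const_seq count_predT iter_addr addr0.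
  rewrite -(size_map sig) (perm_size permI1) -[leLHS]mulr_natr /eta mulrAC.
  rewrite ler_pdivrMr// ler_wpM2l ?(ltW e30)// ler_nat size_filter.
  exact: leq_trans (count_size _ _) _.
have H2 : `|\sum_(i <- I2) g D i| <= e / 3.
  apply: le_trans (ler_norm_sum _ _ _) _.
  pose J i : R * R := (i.-1%:R * D, i%:R * D).
  have := Lf [seq J i | i <- I2]; rewrite big_map; apply.
    apply/andP; split; rewrite ?all_map ?pairwise_map.
      apply/allP => i /I_range[[j ->] jm _ _] /=.
      by rewrite mulr_ge0 ?(ltW D0)//= ler_pM2r// ler_nat leqnSn (mT _ jm).
    apply: subseq_pairwise (filter_subseq _ _) _.
    apply: (sub_pairwise (r := ltn)); last first.
      by rewrite -sorted_pairwise; [exact: iota_ltn_sorted|exact: ltn_trans].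
    by move=> i j /= ij; rewrite ler_pM2r// ler_nat -ltnS (ltn_predK ij).
  rewrite all_map; apply/allP => i /I_range[[j ->] jm _ jL] /=.
  apply: modh.
  - rewrite mulr_ge0 ?(ltW D0)//=; apply: le_trans (mT _ jm).
    by rewrite ler_pM2r// ler_nat.
  - by rewrite -natr1 mulrDl mul1r ltrDl D0 ltrD2l.
  - move=> u /(sigM j)/le_trans; apply.
    by rewrite leNgt; apply: contra jL => ?; rewrite LE sigT.
set S := \sum_(s <- L | s <= t) Dt s in HD H1.
have -> : Dsum f X w t - (\sum_(i <- I1) g D i + \sum_(i <- I2) g D i) =
    (Dsum f X w t - S) - (\sum_(i <- I1) g D i - S) - \sum_(i <- I2) g D i.
  by rewrite opprB addrA subrK opprD addrA.
apply: le_trans (ler_normB _ _) _; apply: le_trans (lerD (ler_normB _ _) H2) _.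
by lra.
Unshelve. all: by end_near. Qed.

Lemma skorokhod_cvg_Vn :
  skorokhod_cvg (fun n => Vn f (Delta n) X w) (Dsum f X w).
Proof.
have [sigma sigmaP] := choice (fun n => marks_exist (Delta_pos n)).
split; [by move=> n; exact: cadlag_Vn|exact: cadlag_Dsum|].
exists (fun n => cell_change (Delta n) (sigma n)); split.
- by move=> n; have [s0 sC _] := sigmaP n; exact: time_change_cell_change.
- apply: uniform_cvgP => e e0; have e20 : 0 < e / 2 by lra.
  apply: filterS (near_Delta_lt e20) => n De t.
  rewrite /= in_itv/= andbT => t0; have [s0 sC _] := sigmaP n.
  have := cell_change_dist (Delta_pos n) s0 sC t0.
  by rewrite distrC; lra.
- move=> N; apply: uniform_cvgP => e e0.
  apply: filterS (Vn_cell_change_near sigmaP N e0) => n H t.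
  by rewrite /= in_itv/=; exact: H.
Qed.

End limit.

End pathwise.

(** * The limit theorem for semimartingales *)

Section euclidean_norm.
Context {R : realType} {n : nat}.
Implicit Type v : 'rV[R]_n.

Lemma norm_le_enorm v : `|v| <= enorm v.
Proof.
rewrite [leLHS]mx_normrE; apply: bigmax_le => [|[i j] _].
  exact: sqrtr_ge0.
rewrite (ord1 i)/= -sqrtr_sqr ler_wsqrtr// (bigD1 j)//= lerDl.
by apply: sumr_ge0 => k _; exact: sqr_ge0.
Qed.

Lemma enorm_le_norm v : enorm v <= n%:R * `|v|.
Proof.
rewrite -[leRHS]ger0_norm ?mulr_ge0// -sqrtr_sqr ler_wsqrtr//.
apply: (@le_trans _ _ (\sum_(j < n) `|v| ^+ 2)).
  apply: ler_sum => j _; rewrite -[leLHS]real_normK ?num_real//.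
  by rewrite ler_sqr ?nnegrE// coord_norm_le.
rewrite sumr_const card_ord -[leLHS]mulr_natl exprMn ler_wpM2r ?sqr_ge0//.
by rewrite -natrX ler_nat; case: (n) => // k; rewrite -mulnn leq_pmulr.
Qed.

End euclidean_norm.

Section semimartingale_limit.
Context {R : realType} {disp : measure_display} {Omega : measurableType disp}.
Variables (P : probability Omega R) (F : R -> set (set Omega)).

Lemma locally_bounded_ae (G : R -> Omega -> R) : locally_bounded P F G ->
  {ae P, forall w, forall T : R, exists C, 0 <= C /\
    forall s, 0 <= s <= T -> G s w <= C}.
Proof.
move=> [tau [_ aetau] tauG]; apply: filterS aetau => w [_ tauy] T.
have /cvgeyPge/(_ T)[n _ Hn] := tauy.
exists n.+1%:R; split => // s /andP[s0 sT]; apply: tauG => //.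
by apply: (le_trans _ (Hn n (leqnn n))); rewrite lee_fin.
Qed.

Lemma local_growth_ae {d q : nat} (p : R) (V : set 'rV[R]_d)
    (f : Omega -> R -> 'rV[R]_d -> 'rV[R]_d -> 'rV[R]_q) :
  nbhs (0 : 'rV[R]_d) V -> 0 < p ->
  (forall K : R, 0 < K ->
    exists2 Gamma : R -> Omega -> R, locally_bounded P F Gamma &
      forall w (s : R) z x, 0 <= s -> enorm z <= K -> V x ->
        enorm (f w s z x) <= Gamma s w * enorm x `^ p) ->
  {ae P, forall w, forall T K : R, exists eps G : R, [/\ 0 < eps, 0 <= G &
    forall s z y, 0 <= s <= T -> `|z| <= K -> `|y| <= eps ->
      `|f w s z y| <= G * `|y| `^ p]}.
Proof.
move=> /nbhs_ballP[r /= r0 rV] p0 fV.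
have H : {ae P, forall w, forall (k : nat) (T : R), exists C, 0 <= C /\
    forall s z y, 0 <= s <= T -> enorm z <= k.+1%:R -> V y ->
      enorm (f w s z y) <= C * enorm y `^ p}.
  apply/ae_foralln => k; have [Gam lbG fG] := fV k.+1%:R (ltr0Sn _ _).
  apply: filterS (locally_bounded_ae lbG) => w GC T.
  have [C [C0 HC]] := GC T; exists C; split => // s z y sT zk yV.
  have /andP[s0 _] := sT; apply: le_trans (fG _ _ _ _ s0 zk yV) _.
  by rewrite ler_wpM2r ?powR_ge0// HC.
apply: filterS H => w H T K.
have [C [C0 HC]] := H (Num.truncn (d%:R * K)) T.
exists (r / 2), (C * d%:R `^ p); split; first by rewrite divr_gt0.
  by rewrite mulr_ge0 ?powR_ge0.
move=> s z y sT zK yr; apply: le_trans (norm_le_enorm _) _.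
apply: le_trans (HC s z y sT _ _) _.
- apply: le_trans (enorm_le_norm z) (le_trans _ (ltW (truncnS_gt _))).
  by rewrite ler_wpM2l.
- apply: rV; rewrite -ball_normE /ball_/= sub0r normrN.
  by apply: le_lt_trans yr _; lra.
rewrite -mulrA ler_wpM2l// -powRM//.
apply: ge0_ler_powR; rewrite ?nnegrE ?(ltW p0) ?mulr_ge0 ?sqrtr_ge0//.
exact: enorm_le_norm.
Qed.

End semimartingale_limit.

Theorem theorem2p2 (R : realType) (disp : measure_display)
    (Omega : measurableType disp) (P : probability Omega R)
    (F : R -> set (set Omega)) (hF : filtration F)
    (Delta : nat -> R) (hDelta_pos : forall n, 0 < Delta n)
    (hDelta_lim : Delta @ \oo --> (0 : R))
    (d q : nat) (X : R -> Omega -> 'rV[R]_d) (hX : semimartingale P F X)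
    (f : Omega -> R -> 'rV[R]_d -> 'rV[R]_d -> 'rV[R]_q)
    (hK : hypK f [set: 'rV[R]_d])
    (hf : exists (V : set 'rV[R]_d) (p : R),
        [/\ nbhs (0 : 'rV[R]_d) V, 2 < p &
            forall K : R, 0 < K ->
              exists2 Gamma : R -> Omega -> R, locally_bounded P F Gamma &
                forall w (s : R) z x, 0 <= s -> enorm z <= K -> V x ->
                  enorm (f w s z x) <= Gamma s w * enorm x `^ p]) :
  {ae P, forall w : Omega,
    (forall t : R, 0 <= t -> Dsummable f X w t) /\
    skorokhod_cvg (fun n => Vn f (Delta n) X w) (Dsum f X w)}.
Proof.
have [V [p [V0 p2 fV]]] := hf; have p0 : 0 < p by lra.
(* any exponent strictly between 2 and [p] *)
pose p' := (p + 2) / 2; have p'2 : 2 < p' by rewrite /p'; lra.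
have p'0 : 0 < p' by lra.
have p'p : p' < p by rewrite /p'; lra.
have aeX := semimartingale_finite_pvar hF hX p'2.
apply: filterS2 aeX (local_growth_ae V0 p0 fV) => w xp' fw.
have cX := semimartingale_cadlag hX w.
have fl t z y : 0 < t -> exists l, is_left_value f w t z y l.
  by move=> t0; have [_] := hK; apply.
split; first exact: (Dterms_summable p'0 p'p cX xp' fl fw).
exact: (skorokhod_cvg_Vn p'0 p'p cX xp' fl fw hDelta_pos hDelta_lim).
Qed.
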